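(* Let $s,t,\lambda$ be real numbers and $\alpha=\min\{s,t\}$. Define on $(-\alpha,\infty)$ \[ \mathcal{H}_{s,t;\lambda}(x)=\begin{cases}\dfrac{(x+t)^{[1/(t-s)-\lambda]/2}}{(x+s)^{[1/(t-s)+\lambda]/2}}\left[\dfrac{\Gamma(x+t)}{\Gamma(x+s)}\right]^{1/(t-s)},& s\ne t,\\[1em] \dfrac{1}{(x+s)^{\lambda}}\exp\!\left[\psi(x+s)+\dfrac{1}{2(x+s)}\right],& s=t.\end{cases} \] Then: \begin{enumerate} \item For $0<|t-s|<1$: (a) $\mathcal{H}_{s,t;\lambda}$ is logarithmically completely monotonic on $(-\alpha,\infty)$ if and only if $\lambda\ge\frac{1}{|t-s|}$; (b) $[\mathcal{H}_{s,t;\lambda}]^{-1}$ is logarithmically completely monotonic on $(-\alpha,\infty)$ if and only if $\lambda\le 1$. \item For $|t-s|>1$: (a) $\mathcal{H}_{s,t;\lambda}$ is logarithmically completely monotonic on $(-\alpha,\infty)$ if and only if $\lambda\ge 1$; (b) $[\mathcal{H}_{s,t;\lambda}]^{-1}$ is logarithmically completely monotonic on $(-\alpha,\infty)$ if and only if $\lambda\le\frac{1}{|t-s|}$. \item For $s=t$: $[\mathcal{H}_{s,s;\lambda}]^{-1}$ is logarithmically completely monotonic on $(-s,\infty)$ if and only if $\lambda\le 1$. \item For $|t-s|=1$: (a) $\mathcal{H}_{s,t;\lambda}$ is logarithmically completely monotonic on $(-\alpha,\infty)$ if and only if $\lambda>1$; (b) $[\mathcal{H}_{s,t;\lambda}]^{-1}$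 is logarithmically completely monotonic on $(-\alpha,\infty)$ if and only if $\lambda<1$; (c) $\mathcal{H}_{s,t;1}(x)\equiv 1$. \end{enumerate}
   Context: $\Gamma$ is Euler's gamma function and $\psi=\Gamma'/\Gamma$ is the digamma function. A positive function $f$ on an interval $I$ is logarithmically completely monotonic on $I$ if it has derivatives of all orders on $I$ and $(-1)^k[\ln f(x)]^{(k)}\ge 0$ for all $x\in I$ and all $k\in\mathbb{N}=\{1,2,\dots\}$.
   Formalization: In item 4, (a) and (b) are stated only for λ ≠ 1, because at λ = 1 the function is identically 1 and so both it and its reciprocal are logarithmically completely monotonic, making the equivalences with λ > 1 and λ < 1 false there. *)

(* Defs.v *)
From Stdlib Require Import Reals.
From Coquelicot Require Import Coquelicot.
Open Scope R_scope.

(* Euler's gamma function on (0,oo), via Euler's integral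
   Gamma(x) = int_0^oo u^(x-1) e^(-u) du  (only used for x > 0). *)
Definition Gamma (x : R) : R :=
  RInt_gen (fun u => Rpower u (x - 1) * exp (- u))
           (at_right 0) (Rbar_locally p_infty).

Definition psi (x : R) : R := Derive Gamma x / Gamma x.

Definition log_completely_monotonic (f : R -> R) (I : R -> Prop) : Prop :=
  (forall x, I x -> 0 < f x) /\
  (forall (k : nat) x, I x -> ex_derive_n f k x) /\
  (forall (k : nat) x, I x -> (1 <= k)%nat ->
      0 <= (-1) ^ k * Derive_n (fun y => ln (f y)) k x).

Definition dom (s t : R) : R -> Prop := fun x => - Rmin s t < x.

Definition H (s t lam : R) (x : R) : R :=
  if Req_EM_T s t then
    / Rpower (x + s) lam * exp (psi (x + s) + 1 / (2 * (x + s)))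
  else
    Rpower (x + t) ((1 / (t - s) - lam) / 2)
    / Rpower (x + s) ((1 / (t - s) + lam) / 2)
    * Rpower (Gamma (x + t) / Gamma (x + s)) (1 / (t - s)).

(* Main.v *)
Require Import Defs.
From Stdlib Require Import Reals.
From Coquelicot Require Import Coquelicot.
From Stdlib Require Import Factorial Lra Lia Psatz.
Open Scope R_scope.

(** Write [a = x + s], [b = x + t], [d = t - s > 0] (the formula is symmetric in [s] and [t]).
    The [k]-th derivative of [ln H] is [(-1)^(k-1) (k-1)!] times
    [D k = (U k a - U k b) / d + (b^(-k) - a^(-k)) / (2 d) - lam / 2 * (a^(-k) + b^(-k))],
    where [U 1 = - psi] and [U k x] is the sum of [(x + n)^(-k)] for [k >= 2], so logarithmic complete
    monotonicity says that every [D k] has constant sign.  As [D k x] tends to [0] at infinity,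
    its sign is that of [D k x - D k (x + 1)], in which [psi] has disappeared: it compares the
    powers [y^(-k)] at the four points [a], [b], [a + 1], [b + 1].  The bound [lam = 1 / d]
    only needs to compare [b] with [a + 1]; the bound [lam = 1] is the monotonicity in [w] of
    [((c - w)^(-k) - (c + w)^(-k)) / w], [c] being the centre of the four points.
    Necessity is read off [D 1] as [x] tends to infinity ([lam] against [1]) and as [a] tends
    to [0] ([lam] against [1 / d]).  The case [s = t] is analogous, with the trapezoidal rule
    for [y^(-k-1)] on [[a, a + 1]] as the elementary inequality.

    That [psi' x] is the sum of [(x + n)^(-2)] follows from the Bohr-Mollerup argument, which
    avoids differentiating Euler's integral. *)

(** * Sums of inverse powers *)

(** The mean value inequality is applied twice, to [f'] and then to [f] minus its tangent at [x];
    hence the constant [M] instead of [M / 2]. *)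
Lemma taylor1_bound (f f' f'' : R -> R) (x y r M : R) :
  Rabs (y - x) < r ->
  (forall z, Rabs (z - x) < r ->
     is_derive f z (f' z) /\ is_derive f' z (f'' z) /\ Rabs (f'' z) <= M) ->
  Rabs (f y - f x - f' x * (y - x)) <= M * (y - x) ^ 2.
Proof.
  intros Hy Hd.
  assert (Hf' : forall z, Rabs (z - x) <= Rabs (y - x) ->
            Rabs (f' z - f' x) <= M * Rabs (y - x)).
  { intros z Hz.
    apply Rle_trans with (M * Rabs (z - x)).
    - apply (bounded_variation f' f'' M x z); intros w Hw.
      destruct (Hd w) as (_ & ? & ?); [lra | auto].
    - apply Rmult_le_compat_l; [ | exact Hz].
      destruct (Hd x) as (_ & _ & Hx).
      + replace (x - x) with 0 by ring; rewrite Rabs_R0.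
        pose proof (Rabs_pos (y - x)); lra.
      + pose proof (Rabs_pos (f'' x)); lra. }
  replace (f y - f x - f' x * (y - x))
    with ((f y - f' x * y) - (f x - f' x * x)) by ring.
  replace (M * (y - x) ^ 2) with (M * Rabs (y - x) * Rabs (y - x))
    by (rewrite <- (pow2_abs (y - x)); ring).
  apply (bounded_variation (fun w => f w - f' x * w) (fun w => f' w - f' x) _ x y).
  intros w Hw; split; [ | auto].
  destruct (Hd w) as (Hw1 & _); [lra | ].
  auto_derive.
  - exists (f' w); exact Hw1.
  - replace (Derive (fun x0 => f x0) w) with (f' w) by (symmetry; apply is_derive_unique, Hw1); ring.
Qed.

Lemma is_derive_quadratic (f : R -> R) (x l r M : R) :
  0 < r ->
  (forall y, Rabs (y - x) < r -> Rabs (f y - f x - l * (y - x)) <= M * (y - x) ^ 2) ->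
  is_derive f x l.
Proof.
  intros Hr H. apply is_derive_Reals. intros eps Heps.
  assert (HM : 0 <= Rabs M) by apply Rabs_pos.
  (* The [+ 1] keeps the denominator positive when [M = 0]. *)
  assert (Hd : 0 < Rmin r (eps / (Rabs M + 1))).
  { apply Rmin_pos; [exact Hr | apply Rdiv_lt_0_compat; lra]. }
  exists (mkposreal _ Hd). intros h Hh0 Hh. simpl in Hh.
  pose proof (Rmin_l r (eps / (Rabs M + 1))).
  pose proof (Rmin_r r (eps / (Rabs M + 1))).
  specialize (H (x + h)). replace (x + h - x) with h in H by ring.
  specialize (H ltac:(lra)).
  replace ((f (x + h) - f x) / h - l) with ((f (x + h) - f x - l * h) / h) by (field; exact Hh0).
  rewrite Rabs_div by exact Hh0.
  assert (Hh' : 0 < Rabs h) by (apply Rabs_pos_lt; exact Hh0).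
  apply Rmult_lt_reg_r with (Rabs h); [exact Hh' | ].
  unfold Rdiv; rewrite Rmult_assoc, Rinv_l, Rmult_1_r by lra.
  apply Rle_lt_trans with (Rabs M * Rabs h * Rabs h).
  - apply Rle_trans with (1 := H). rewrite <- (pow2_abs h).
    pose proof (Rle_abs M). nra.
  - apply Rmult_lt_compat_r; [exact Hh' | ].
    apply Rle_lt_trans with ((Rabs M) * (eps / (Rabs M + 1))).
    + apply Rmult_le_compat_l; lra.
    + apply Rmult_lt_reg_r with (Rabs M + 1); [lra | ].
      replace (Rabs M * (eps / (Rabs M + 1)) * (Rabs M + 1)) with (Rabs M * eps) by (field; lra).
      nra.
Qed.

(** Quadratic Taylor bounds add up termwise, so summable bounds [M n] on the second derivatives take
    the place of uniform convergence of the differentiated series. *)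
Lemma is_derive_Series (f f' f'' : nat -> R -> R) (M : nat -> R) (x r : R) :
  0 < r ->
  (forall n z, Rabs (z - x) < r ->
     is_derive (f n) z (f' n z) /\ is_derive (f' n) z (f'' n z) /\ Rabs (f'' n z) <= M n) ->
  (forall z, Rabs (z - x) < r -> ex_series (fun n => f n z)) ->
  ex_series (fun n => f' n x) ->
  ex_series M ->
  is_derive (fun z => Series (fun n => f n z)) x (Series (fun n => f' n x)).
Proof.
  intros Hr Hd Hf Hf' HM.
  assert (Hfx : ex_series (fun n => f n x)).
  { apply Hf. replace (x - x) with 0 by ring. rewrite Rabs_R0. exact Hr. }
  apply is_derive_quadratic with r (Series M); [exact Hr | ].
  intros y Hy. specialize (Hf y Hy).
  rewrite <- Series_minus, <- Series_scal_r, <- Series_minus, <- Series_scal_r; auto.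
  - assert (Hb : forall n, 0 <= Rabs (f n y - f n x - f' n x * (y - x)) <= M n * (y - x) ^ 2).
    { intros n; split; [apply Rabs_pos | ].
      apply taylor1_bound with (f'' := f'' n) (r := r); auto. }
    assert (He : ex_series (fun n => M n * (y - x) ^ 2)) by (apply ex_series_scal_r, HM).
    apply Rle_trans with (2 := Series_le _ _ Hb He).
    apply Series_Rabs.
    apply (ex_series_le (V := R_CompleteNormedModule)) with (2 := He). intros n. change norm with Rabs.
    rewrite Rabs_Rabsolu; apply Hb.
  - apply (ex_series_minus (V := R_NormedModule)); assumption.
  - apply ex_series_scal_r, Hf'.
Qed.

(** The Hurwitz zeta function at an integer [k]; for [x > 0] the series converges exactly when
    [k >= 2]. *)
Definition hurwitz (k : nat) (x : R) : R := Series (fun n => (/ (x + INR n)) ^ k).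

(** For [x > 0] this is [psi x] plus Euler's constant; subtracting from [/ (1 + INR n)] makes the
    series converge. *)
Definition digamma0 (x : R) : R := Series (fun n => / (1 + INR n) - / (x + INR n)).

Lemma is_series_telescope (x : R) : 0 < x ->
  is_series (fun n => / (x + INR n) - / (x + INR n + 1)) (/ x).
Proof.
  intros Hx.
  change (is_lim_seq (sum_n (fun n => / (x + INR n) - / (x + INR n + 1))) (Finite (/ x))).
  apply (is_lim_seq_ext (fun n => / x - / (x + INR n + 1))).
  - intros n. induction n as [ | n IH].
    + rewrite sum_O; simpl INR; rewrite Rplus_0_r; reflexivity.
    + rewrite sum_Sn, <- IH, S_INR. unfold plus; simpl.
      replace (x + (INR n + 1)) with (x + INR n + 1) by ring. ring.
  - replace (Finite (/ x)) with (Finite (/ x - 0)) by (f_equal; ring).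
    apply (is_lim_seq_minus' _ _ (/ x) 0); [apply is_lim_seq_const | ].
    apply (is_lim_seq_inv _ p_infty); [ | discriminate].
    apply is_lim_seq_ext with (fun n => INR n + (x + 1)); [intros; ring | ].
    apply is_lim_seq_plus with p_infty (x + 1); [apply is_lim_seq_INR | apply is_lim_seq_const | ].
    reflexivity.
Qed.

Lemma inv_pos_INR (x : R) (n : nat) : 0 < x -> 0 < / (x + INR n) <= / x.
Proof.
  intros Hx. pose proof (pos_INR n). split.
  - apply Rinv_0_lt_compat; lra.
  - apply Rinv_le_contravar; lra.
Qed.

(** The difference is the product of two consecutive reciprocals, hence lies between their squares.
    This compares [hurwitz 2] with a telescoping series. *)
Lemma telescope_le_sqr (x : R) (n : nat) : 0 < x ->
  (/ (x + INR n + 1)) ^ 2 <= / (x + INR n) - / (x + INR n + 1) <= (/ (x + INR n)) ^ 2.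
Proof.
  intros Hx. pose proof (pos_INR n).
  replace (/ (x + INR n) - / (x + INR n + 1)) with (/ (x + INR n) * / (x + INR n + 1))
    by (field; lra).
  assert (0 < / (x + INR n + 1) <= / (x + INR n)).
  { split; [apply Rinv_0_lt_compat; lra | apply Rinv_le_contravar; lra]. }
  split; nra.
Qed.

Lemma ex_series_hurwitz2 (x : R) : 0 < x -> ex_series (fun n => (/ (x + INR n)) ^ 2).
Proof.
  intros Hx. apply ex_series_incr_1.
  apply (ex_series_le (V := R_CompleteNormedModule)) with
    (fun n => / (x + INR n) - / (x + INR n + 1)).
  - intros n. change norm with Rabs. rewrite Rabs_right by (apply Rle_ge, pow2_ge_0).
    rewrite S_INR. replace (x + (INR n + 1)) with (x + INR n + 1) by ring.
    apply telescope_le_sqr, Hx.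
  - exists (/ x). apply is_series_telescope, Hx.
Qed.

Lemma hurwitz_term_le (k : nat) (x : R) (n : nat) : (2 <= k)%nat -> 0 < x ->
  0 <= (/ (x + INR n)) ^ k <= (/ x) ^ (k - 2) * (/ (x + INR n)) ^ 2.
Proof.
  intros Hk Hx. destruct (inv_pos_INR x n Hx) as [H1 H2]. split.
  - apply pow_le; lra.
  - replace k with ((k - 2) + 2)%nat at 1 by lia. rewrite pow_add.
    apply Rmult_le_compat_r; [apply pow2_ge_0 | ].
    apply pow_incr; lra.
Qed.

Lemma ex_series_hurwitz (k : nat) (x : R) : (2 <= k)%nat -> 0 < x ->
  ex_series (fun n => (/ (x + INR n)) ^ k).
Proof.
  intros Hk Hx.
  apply (ex_series_le (V := R_CompleteNormedModule)) with
    (fun n => (/ x) ^ (k - 2) * (/ (x + INR n)) ^ 2).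
  - intros n. change norm with Rabs.
    destruct (hurwitz_term_le k x n Hk Hx). rewrite Rabs_right; lra.
  - apply (ex_series_scal_l ((/ x) ^ (k - 2)) (fun n => (/ (x + INR n)) ^ 2)).
    apply ex_series_hurwitz2, Hx.
Qed.

Lemma hurwitz_shift (k : nat) (x : R) : (2 <= k)%nat -> 0 < x ->
  hurwitz k (x + 1) = hurwitz k x - (/ x) ^ k.
Proof.
  intros Hk Hx. unfold hurwitz.
  rewrite (Series_incr_1 (fun n => (/ (x + INR n)) ^ k)) by (apply ex_series_hurwitz; assumption).
  change (INR 0) with 0. rewrite Rplus_0_r.
  rewrite (Series_ext (fun n => (/ (x + 1 + INR n)) ^ k) (fun n => (/ (x + INR (S n))) ^ k)).
  - ring.
  - intros n. rewrite S_INR. do 2 f_equal; ring.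
Qed.

Lemma hurwitz2_bounds (x : R) : 0 < x -> / x <= hurwitz 2 x <= / x + (/ x) ^ 2.
Proof.
  intros Hx.
  assert (Hge : forall y, 0 < y -> / y <= hurwitz 2 y).
  { intros y Hy. rewrite <- (is_series_unique _ _ (is_series_telescope y Hy)).
    apply Series_le; [ | apply ex_series_hurwitz2, Hy].
    intros n. pose proof (telescope_le_sqr y n Hy).
    pose proof (pow2_ge_0 (/ (y + INR n + 1))). lra. }
  split; [apply Hge, Hx | ].
  (* The telescoping terms dominate the squares only after a unit shift, so the upper bound is
     proved at [x + 1] and carried back. *)
  enough (hurwitz 2 (x + 1) <= / x) by (rewrite hurwitz_shift in H by (lia || lra); lra).
  rewrite <- (is_series_unique _ _ (is_series_telescope x Hx)).
  apply Series_le; [ | exists (/ x); apply is_series_telescope, Hx].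
  intros n. replace (x + 1 + INR n) with (x + INR n + 1) by ring.
  split; [apply pow2_ge_0 | apply telescope_le_sqr, Hx].
Qed.

Lemma hurwitz_decay (k : nat) (x : R) : (2 <= k)%nat -> 1 <= x ->
  0 <= hurwitz k x <= 2 / x.
Proof.
  intros Hk Hx.
  assert (H2 : hurwitz 2 x <= 2 / x).
  { destruct (hurwitz2_bounds x) as [_ H]; [lra | ].
    assert (0 < / x <= 1) by (split; [apply Rinv_0_lt_compat; lra | rewrite <- Rinv_1; apply Rinv_le_contravar; lra]).
    unfold Rdiv; nra. }
  assert (Hb : forall n, 0 <= (/ (x + INR n)) ^ k <= (/ (x + INR n)) ^ 2).
  { intros n. destruct (hurwitz_term_le k x n Hk) as [Hl Hu]; [lra | split; [exact Hl | ]].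
    apply Rle_trans with (1 := Hu). rewrite <- (Rmult_1_l ((/ (x + INR n)) ^ 2)) at 2.
    apply Rmult_le_compat_r; [apply pow2_ge_0 | ].
    rewrite <- (pow1 (k - 2)). apply pow_incr. split.
    - left; apply Rinv_0_lt_compat; lra.
    - rewrite <- Rinv_1; apply Rinv_le_contravar; lra. }
  split.
  - unfold hurwitz.
    rewrite <- (Rmult_0_l (Series (fun n => (/ (x + INR n)) ^ k))), <- Series_scal_l.
    apply Series_le.
    + intros n. specialize (Hb n). lra.
    + apply ex_series_hurwitz; lra || lia.
  - apply Rle_trans with (2 := H2). apply Series_le; [exact Hb | ].
    apply ex_series_hurwitz2; lra.
Qed.

Lemma is_derive_inv_pow (k : nat) (c x : R) : 0 < x + c ->
  is_derive (fun y => (/ (y + c)) ^ k) x (- INR k * (/ (x + c)) ^ S k).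
Proof.
  intros Hx. auto_derive; [lra | ].
  destruct k as [ | k]; [simpl; ring | ].
  rewrite S_INR; simpl; field; lra.
Qed.

Lemma half_ball (x z : R) : Rabs (z - x) < x / 2 -> x / 2 < z.
Proof. intros H. apply Rabs_def2 in H. lra. Qed.

Lemma hurwitz_derive (k : nat) (x : R) : (2 <= k)%nat -> 0 < x ->
  is_derive (hurwitz k) x (- INR k * hurwitz (S k) x).
Proof.
  intros Hk Hx. unfold hurwitz. rewrite <- Series_scal_l.
  (* On the ball of radius [x / 2] every point exceeds [x / 2], so the second derivatives are
     dominated by their values at [x / 2]. *)
  apply (is_derive_Series (fun n y => (/ (y + INR n)) ^ k)
           (fun n y => - INR k * (/ (y + INR n)) ^ S k)
           (fun n y => - INR k * (- INR (S k) * (/ (y + INR n)) ^ S (S k)))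
           (fun n => INR k * INR (S k) * (/ (x / 2 + INR n)) ^ S (S k)) x (x / 2)).
  - lra.
  - intros n z Hz. apply half_ball in Hz. pose proof (pos_INR n).
    split; [ | split].
    + apply is_derive_inv_pow; lra.
    + apply is_derive_scal, is_derive_inv_pow; lra.
    + assert (Hp : 0 <= (/ (z + INR n)) ^ S (S k) <= (/ (x / 2 + INR n)) ^ S (S k)).
      { assert (0 < / (z + INR n)) by (apply Rinv_0_lt_compat; lra). split.
        - apply pow_le; lra.
        - apply pow_incr; split; [lra | apply Rinv_le_contravar; lra]. }
      pose proof (pos_INR k). pose proof (pos_INR (S k)).
      assert (0 <= INR k * INR (S k)) by nra.
      rewrite Rabs_right; nra.
  - intros z Hz. apply half_ball in Hz. apply ex_series_hurwitz; lra || lia.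
  - apply (ex_series_scal_l (- INR k) (fun n => (/ (x + INR n)) ^ S k)).
    apply ex_series_hurwitz; lra || lia.
  - apply (ex_series_scal_l (INR k * INR (S k)) (fun n => (/ (x / 2 + INR n)) ^ S (S k))).
    apply ex_series_hurwitz; lra || lia.
Qed.

Lemma ex_series_digamma0 (x : R) : 0 < x ->
  ex_series (fun n => / (1 + INR n) - / (x + INR n)).
Proof.
  intros Hx.
  (* Each term is [x - 1] times a product of two reciprocals, and that product is at most the sum of
     their squares. *)
  apply (ex_series_le (V := R_CompleteNormedModule)) with
    (fun n => Rabs (x - 1) * ((/ (1 + INR n)) ^ 2 + (/ (x + INR n)) ^ 2)).
  - intros n. change norm with Rabs. pose proof (pos_INR n).
    replace (/ (1 + INR n) - / (x + INR n))
      with ((x - 1) * (/ (1 + INR n) * / (x + INR n))) by (field; lra).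
    rewrite Rabs_mult. apply Rmult_le_compat_l; [apply Rabs_pos | ].
    assert (0 < / (1 + INR n)) by (apply Rinv_0_lt_compat; lra).
    assert (0 < / (x + INR n)) by (apply Rinv_0_lt_compat; lra).
    rewrite Rabs_right by (apply Rle_ge, Rmult_le_pos; lra). nra.
  - apply (ex_series_scal_l (Rabs (x - 1))
             (fun n => (/ (1 + INR n)) ^ 2 + (/ (x + INR n)) ^ 2)).
    apply (ex_series_plus (V := R_NormedModule)
             (fun n => (/ (1 + INR n)) ^ 2) (fun n => (/ (x + INR n)) ^ 2));
      apply ex_series_hurwitz2; lra.
Qed.

Lemma digamma0_shift (x : R) : 0 < x -> digamma0 (x + 1) = digamma0 x + / x.
Proof.
  intros Hx. unfold digamma0.
  rewrite <- (is_series_unique _ _ (is_series_telescope x Hx)), <- Series_plus.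
  - apply Series_ext. intros n. replace (x + 1 + INR n) with (x + INR n + 1) by ring. ring.
  - apply ex_series_digamma0, Hx.
  - exists (/ x). apply is_series_telescope, Hx.
Qed.

Lemma digamma0_derive (x : R) : 0 < x -> is_derive digamma0 x (hurwitz 2 x).
Proof.
  intros Hx. unfold digamma0, hurwitz.
  apply (is_derive_Series (fun n y => / (1 + INR n) - / (y + INR n))
           (fun n y => (/ (y + INR n)) ^ 2)
           (fun n y => - INR 2 * (/ (y + INR n)) ^ 3)
           (fun n => INR 2 * (/ (x / 2 + INR n)) ^ 3) x (x / 2)).
  - lra.
  - intros n z Hz. apply half_ball in Hz. pose proof (pos_INR n).
    split; [ | split].
    + auto_derive; [lra | field; lra].
    + apply is_derive_inv_pow; lra.
    + assert (Hp : 0 <= (/ (z + INR n)) ^ 3 <= (/ (x / 2 + INR n)) ^ 3).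
      { assert (0 < / (z + INR n)) by (apply Rinv_0_lt_compat; lra). split.
        - apply pow_le; lra.
        - apply pow_incr; split; [lra | apply Rinv_le_contravar; lra]. }
      change (INR 2) with 2. rewrite Rabs_mult, Rabs_Ropp.
      rewrite (Rabs_right 2), Rabs_right; lra.
  - intros z Hz. apply half_ball in Hz. apply ex_series_digamma0; lra.
  - apply ex_series_hurwitz2; lra.
  - apply (ex_series_scal_l (INR 2) (fun n => (/ (x / 2 + INR n)) ^ 3)).
    apply ex_series_hurwitz; lra || lia.
Qed.

(** * Euler's integral *)

Definition gfun (x u : R) : R := Rpower u (x - 1) * exp (- u).

Lemma filter_prod_interval (P : R -> R -> Prop) (a0 b0 : R) :
  0 < a0 ->
  (forall a b, 0 < a < a0 -> b0 < b -> P a b) ->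
  filter_prod (at_right 0) (Rbar_locally p_infty) (fun ab => P (fst ab) (snd ab)).
Proof.
  intros Ha0 H.
  apply Filter_prod with (fun a => 0 < a < a0) (fun b => b0 < b).
  - exists (mkposreal _ Ha0). intros y Hy Hy0.
    split; [exact Hy0 | ].
    unfold ball in Hy; simpl in Hy; unfold AbsRing_ball, abs, minus, plus, opp in Hy; simpl in Hy.
    apply Rabs_def2 in Hy; lra.
  - exists b0; auto.
  - intros a b Ha Hb; simpl; auto.
Qed.

Lemma exp_le (p q : R) : p <= q -> exp p <= exp q.
Proof. intros [H | ->]; [left; apply exp_increasing, H | right; reflexivity]. Qed.

Lemma ex_RInt_cont_pos (f : R -> R) (a b : R) :
  (forall u, 0 < u -> continuous f u) -> 0 < a -> 0 < b -> ex_RInt f a b.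
Proof.
  intros Hf Ha Hb. apply (ex_RInt_continuous (V := R_CompleteNormedModule)).
  intros z Hz. apply Hf. pose proof (Rmin_glb_lt a b 0 Ha Hb). lra.
Qed.

Lemma locally_pos (x : R) : 0 < x -> locally x (fun y => 0 < y).
Proof.
  intros Hx. apply (open_gt 0 x Hx).
Qed.

Lemma is_derive_RInt_pos (f : R -> R) (a x : R) :
  (forall u, 0 < u -> continuous f u) -> 0 < a -> 0 < x ->
  is_derive (fun y => RInt f a y) x (f x).
Proof.
  intros Hf Ha Hx.
  apply (is_derive_RInt (V := R_NormedModule) f _ a); [ | apply Hf, Hx].
  generalize (locally_pos x Hx); apply filter_imp. intros y Hy.
  apply (RInt_correct (V := R_CompleteNormedModule)), ex_RInt_cont_pos; assumption.
Qed.

(** For a nonnegative integrand the integral grows with the interval, so the supremum over compact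
    intervals is the improper integral. The second conclusion later yields the positivity of
    [Gamma]. *)
Lemma ex_RInt_gen_pos_bounded (f : R -> R) (M : R) :
  (forall u, 0 < u -> continuous f u) ->
  (forall u, 0 < u -> 0 <= f u) ->
  (forall a b, 0 < a <= b -> RInt f a b <= M) ->
  exists l, is_RInt_gen f (at_right 0) (Rbar_locally p_infty) l /\
    forall a b, 0 < a <= b -> RInt f a b <= l.
Proof.
  intros Hc Hp HM.
  destruct (completeness (fun v => exists a b, 0 < a <= b /\ v = RInt f a b)) as [l [Hub Hl]].
  - exists M. intros v (a & b & Hab & ->). auto.
  - exists (RInt f 1 1), 1, 1. split; [lra | reflexivity].
  - assert (Hle : forall a b, 0 < a <= b -> RInt f a b <= l).
    { intros a b Hab. apply Hub. exists a, b. auto. }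
    exists l. split; [ | exact Hle].
    intros P [eps HP].
    assert (Hex : exists a0 b0, 0 < a0 <= b0 /\ l - eps < RInt f a0 b0).
    { apply Classical_Prop.NNPP. intros Hn.
      assert (l <= l - eps); [ | pose proof (cond_pos eps); lra].
      apply Hl. intros v (a & b & Hab & ->).
      apply Rnot_lt_le. intros Hlt. apply Hn. exists a, b. auto. }
    destruct Hex as (a0 & b0 & Hab0 & Hlt).
    apply (filter_prod_interval (fun a b => exists y, is_RInt f a b y /\ P y) a0 b0); [lra | ].
    intros a b Ha Hb. exists (RInt f a b). split.
    + apply (RInt_correct (V := R_CompleteNormedModule)), ex_RInt_cont_pos; [exact Hc | lra | lra].
    + apply HP. unfold ball; simpl; unfold AbsRing_ball, abs, minus, plus, opp; simpl.
      assert (RInt f a b <= l) by (apply Hle; lra).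
      assert (RInt f a0 b0 <= RInt f a b).
      { rewrite <- (RInt_Chasles f a a0 b), <- (RInt_Chasles f a0 b0 b);
          try (apply ex_RInt_cont_pos; [exact Hc | lra | lra]).
        assert (0 <= RInt f a a0).
        { apply RInt_ge_0; [lra | apply ex_RInt_cont_pos; [exact Hc | lra | lra] | ].
          intros u Hu; apply Hp; lra. }
        assert (0 <= RInt f b0 b).
        { apply RInt_ge_0; [lra | apply ex_RInt_cont_pos; [exact Hc | lra | lra] | ].
          intros u Hu; apply Hp; lra. }
        unfold plus; simpl. lra. }
      apply Rabs_def1; lra.
Qed.

(** The tangent to [ln] at [K], multiplied by [K]; it lets an exponential absorb a power of [v]. *)
Lemma ln_le_linear (K v : R) : 0 < K -> 0 < v -> K * ln v <= v + K * (ln K - 1).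
Proof.
  intros HK Hv.
  assert (H : ln (v / K) <= v / K - 1).
  { pose proof (exp_ineq1_le (ln (v / K))).
    rewrite exp_ln in H; [lra | apply Rdiv_lt_0_compat; lra]. }
  unfold Rdiv in H. rewrite ln_mult, ln_Rinv in H by (try apply Rinv_0_lt_compat; lra).
  apply (Rmult_le_compat_l K) in H; [ | lra].
  replace (K * (v * / K - 1)) with (v - K) in H by (field; lra). lra.
Qed.

Lemma gfun_pos (x u : R) : 0 < gfun x u.
Proof. apply Rmult_lt_0_compat; apply exp_pos. Qed.

Lemma gfun_derive (x u : R) : 0 < u ->
  is_derive (fun v => - gfun (x + 1) v) u (gfun (x + 1) u - x * gfun x u).
Proof.
  intros Hu. unfold gfun, Rpower. auto_derive; [exact Hu | ].
  replace (x + 1 - 1) with x by ring.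
  replace (exp ((x - 1) * ln u)) with (exp (x * ln u) / u).
  - field; lra.
  - replace ((x - 1) * ln u) with (x * ln u + - ln u) by ring.
    rewrite exp_plus, exp_Ropp, exp_ln by exact Hu. reflexivity.
Qed.

Lemma gfun_continuous (x u : R) : 0 < u -> continuous (gfun x) u.
Proof.
  intros Hu. apply (ex_derive_continuous (V := R_NormedModule)).
  unfold gfun, Rpower. auto_derive. exact Hu.
Qed.

(* The integrand is dominated by the derivative of [(u / (1 + u))^x], a bounded function. *)
Lemma gfun_dominated (x : R) : 0 < x ->
  exists C, 0 < C /\ forall u, 0 < u ->
    exists l, is_derive (fun v => C * Rpower (v / (1 + v)) x) u l /\ gfun x u <= l.
Proof.
  (* [c] is chosen so that [ln_le_linear] at [K = x + 1], [v = 1 + u] reads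
     [(x + 1) * ln (1 + u) <= u + c]. *)
  intros Hx. set (c := 1 + (x + 1) * (ln (x + 1) - 1)).
  exists (exp c / x). split; [apply Rdiv_lt_0_compat; [apply exp_pos | exact Hx] | ].
  intros u Hu.
  exists (exp c * (Rpower u (x - 1) * exp (- ((x + 1) * ln (1 + u))))).
  assert (H0 : 0 < u * / (1 + u)).
  { apply Rmult_lt_0_compat; [exact Hu | apply Rinv_0_lt_compat; lra]. }
  split.
  - unfold Rpower. auto_derive; [split; [lra | split; [exact H0 | exact I]] | ].
    rewrite ln_mult, ln_Rinv by (try apply Rinv_0_lt_compat; lra).
    replace ((x - 1) * ln u) with (x * ln u + - ln u) by ring.
    replace (x * (ln u + - ln (1 + u))) with (x * ln u + - (x * ln (1 + u))) by ring.
    replace (- ((x + 1) * ln (1 + u))) with (- (x * ln (1 + u)) + - ln (1 + u)) by ring.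
    rewrite !exp_plus, (exp_Ropp (ln u)), (exp_Ropp (ln (1 + u))), !exp_ln by lra.
    field. lra.
  - unfold gfun.
    rewrite <- Rmult_assoc, (Rmult_comm (exp c)), Rmult_assoc, <- exp_plus.
    apply Rmult_le_compat_l; [left; apply exp_pos | ].
    assert (- u <= c + - ((x + 1) * ln (1 + u))).
    { pose proof (ln_le_linear (x + 1) (1 + u)). unfold c. lra. }
    apply exp_le, H.
Qed.

(** By domination, [F] minus the integral has a nonnegative derivative, while [F] stays between [0]
    and [C]. *)
Lemma gfun_RInt_bounded (x : R) : 0 < x ->
  exists M, forall a b, 0 < a <= b -> RInt (gfun x) a b <= M.
Proof.
  intros Hx. destruct (gfun_dominated x Hx) as (C & HC & Hd).
  exists C. intros a b Hab.
  set (F := fun v => C * Rpower (v / (1 + v)) x) in *.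
  destruct (MVT_gen (fun w => F w - RInt (gfun x) a w) a b
              (fun w => Derive F w - gfun x w)) as (w & Hw & Heq).
  - intros w Hw. rewrite Rmin_left, Rmax_right in Hw by lra.
    apply (is_derive_minus (V := R_NormedModule) F (fun w => RInt (gfun x) a w)).
    + destruct (Hd w) as (l & Hl & _); [lra | ]. apply Derive_correct. exists l; exact Hl.
    + apply (is_derive_RInt_pos (gfun x)); [apply gfun_continuous | lra | lra].
  - intros w Hw. rewrite Rmin_left, Rmax_right in Hw by lra.
    apply continuity_pt_filterlim.
    apply (continuous_minus (V := R_NormedModule) F (fun w => RInt (gfun x) a w)).
    + apply (ex_derive_continuous (V := R_NormedModule)).
      destruct (Hd w) as (l & Hl & _); [lra | exists l; exact Hl].
    + apply (ex_derive_continuous (V := R_NormedModule)). exists (gfun x w).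
      apply is_derive_RInt_pos; [apply gfun_continuous | lra | lra].
  - rewrite Rmin_left, Rmax_right in Hw by lra.
    rewrite RInt_point in Heq. unfold zero in Heq; simpl in Heq.
    destruct (Hd w) as (l & Hl & Hle); [lra | ].
    replace (Derive F w) with l in Heq by (symmetry; apply is_derive_unique, Hl).
    assert (Hb : F b <= C).
    { unfold F. rewrite <- (Rmult_1_r C) at 2. apply Rmult_le_compat_l; [lra | ].
      unfold Rpower.
      assert (ln (b / (1 + b)) <= 0).
      { rewrite <- ln_1. apply ln_le.
        - apply Rdiv_lt_0_compat; lra.
        - apply Rmult_le_reg_r with (1 + b); [lra | ].
          unfold Rdiv; rewrite Rmult_assoc, Rinv_l; lra. }
      rewrite <- exp_0 at 2. apply exp_le. nra. }
    assert (Ha : 0 <= F a) by (apply Rmult_le_pos; [lra | left; apply exp_pos]).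
    assert (0 <= (l - gfun x w) * (b - a)) by (apply Rmult_le_pos; lra).
    lra.
Qed.

Lemma gfun_RInt_gen (x : R) : 0 < x ->
  is_RInt_gen (gfun x) (at_right 0) (Rbar_locally p_infty) (Gamma x) /\ 0 < Gamma x.
Proof.
  intros Hx. destruct (gfun_RInt_bounded x Hx) as [M HM].
  destruct (ex_RInt_gen_pos_bounded (gfun x) M) as (l & Hl & Hle).
  - intros; apply gfun_continuous; assumption.
  - intros; left; apply gfun_pos.
  - exact HM.
  - assert (Gamma x = l) as -> by exact (is_RInt_gen_unique (V := R_CompleteNormedModule) (gfun x) l Hl).
    split; [exact Hl | ].
    apply Rlt_le_trans with (2 := Hle 1 2 ltac:(lra)).
    apply RInt_gt_0; [lra | intros; apply gfun_pos | ].
    intros u Hu; apply gfun_continuous; lra.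
Qed.

Lemma Gamma_pos (x : R) : 0 < x -> 0 < Gamma x.
Proof. intros Hx; apply gfun_RInt_gen, Hx. Qed.

Lemma gfun_lim_0 (x : R) : 0 < x ->
  filterlim (fun u => - gfun (x + 1) u) (at_right 0) (locally 0).
Proof.
  intros Hx P [eps HP].
  (* This is [eps] to the power [1 / x], so that [u < r] gives [Rpower u x < eps]. *)
  set (r := exp (/ x * ln eps)).
  assert (Hr : 0 < r) by apply exp_pos.
  exists (mkposreal r Hr). intros u Hu Hu0. apply HP.
  unfold ball in Hu |- *; simpl in Hu |- *; unfold AbsRing_ball, abs, minus, plus, opp in Hu |- *; simpl in Hu |- *.
  apply Rabs_def2 in Hu.
  pose proof (gfun_pos (x + 1) u).
  enough (gfun (x + 1) u < eps) by (apply Rabs_def1; lra).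
  unfold gfun. replace (x + 1 - 1) with x by ring.
  apply Rle_lt_trans with (Rpower u x * 1).
  - apply Rmult_le_compat_l; [left; apply exp_pos | ].
    rewrite <- exp_0. left; apply exp_increasing; lra.
  - rewrite Rmult_1_r. rewrite <- (exp_ln eps) by apply cond_pos.
    apply exp_increasing.
    assert (ln u < / x * ln eps) by (rewrite <- (ln_exp (/ x * ln eps)); apply ln_increasing; fold r; lra).
    apply Rmult_lt_reg_l with (/ x); [apply Rinv_0_lt_compat, Hx | ].
    rewrite <- Rmult_assoc, Rinv_l, Rmult_1_l; lra.
Qed.

Lemma gfun_lim_infty (x : R) : 0 < x ->
  filterlim (fun u => - gfun (x + 1) u) (Rbar_locally p_infty) (locally 0).
Proof.
  intros Hx P [eps HP].
  (* [ln_le_linear] at [K = 2 * x] gives [x * ln u - u <= (c - u) / 2], which is below [ln eps] once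
     [u > c - 2 * ln eps]. *)
  set (c := 2 * x * (ln (2 * x) - 1)).
  exists (Rmax 0 (c - 2 * ln eps)). intros u Hu. apply HP.
  unfold ball; simpl; unfold AbsRing_ball, abs, minus, plus, opp; simpl.
  assert (0 < u) by (apply Rle_lt_trans with (1 := Rmax_l _ _) (2 := Hu)).
  assert (c - 2 * ln eps < u) by (apply Rle_lt_trans with (1 := Rmax_r _ _) (2 := Hu)).
  pose proof (gfun_pos (x + 1) u).
  enough (gfun (x + 1) u < eps) by (apply Rabs_def1; lra).
  unfold gfun, Rpower. rewrite <- exp_plus.
  rewrite <- (exp_ln eps) by apply cond_pos. apply exp_increasing.
  pose proof (ln_le_linear (2 * x) u ltac:(lra) ltac:(lra)).
  fold c in H2. lra.
Qed.

(** Integration by parts: the derivative of [- gfun (x + 1)] is integrated once through its boundary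
    limits, both zero, and once by linearity. *)
Lemma Gamma_shift (x : R) : 0 < x -> Gamma (x + 1) = x * Gamma x.
Proof.
  intros Hx.
  assert (Hp : filter_prod (at_right 0) (Rbar_locally p_infty)
            (fun ab => forall u, Rmin (fst ab) (snd ab) <= u -> 0 < u)).
  { apply (filter_prod_interval (fun a b => forall u, Rmin a b <= u -> 0 < u) 1 1); [lra | ].
    intros a b Ha Hb u Hu. pose proof (Rmin_glb_lt a b 0). lra. }
  set (F := fun v => - gfun (x + 1) v).
  assert (HF : is_RInt_gen (Derive F) (at_right 0) (Rbar_locally p_infty) (0 - 0)).
  { apply is_RInt_gen_Derive.
    - revert Hp; apply filter_imp. intros ab Hab u Hu.
      eexists; apply gfun_derive, Hab; apply Hu.
    - revert Hp; apply filter_imp. intros ab Hab u Hu.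
      assert (Hu0 : 0 < u) by (apply Hab; apply Hu).
      apply continuous_ext_loc with (fun v => gfun (x + 1) v - x * gfun x v).
      + generalize (locally_pos u Hu0); apply filter_imp.
        intros y Hy. symmetry. apply is_derive_unique, gfun_derive, Hy.
      + apply (continuous_minus (V := R_NormedModule)).
        * apply gfun_continuous, Hu0.
        * apply (continuous_scal_r (V := R_NormedModule)), gfun_continuous, Hu0.
    - apply gfun_lim_0, Hx.
    - apply gfun_lim_infty, Hx. }
  assert (HF' : is_RInt_gen (Derive F) (at_right 0) (Rbar_locally p_infty)
                  (Gamma (x + 1) - x * Gamma x)).
  { apply is_RInt_gen_ext with (fun v => minus (gfun (x + 1) v) (scal x (gfun x v))).
    - revert Hp; apply filter_imp. intros ab Hab u Hu.
      symmetry. apply is_derive_unique, gfun_derive, Hab. lra.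
    - apply (is_RInt_gen_minus (V := R_NormedModule)).
      + apply gfun_RInt_gen; lra.
      + apply (is_RInt_gen_scal (V := R_NormedModule)), gfun_RInt_gen, Hx. }
  apply (is_RInt_gen_unique (V := R_CompleteNormedModule)) in HF.
  apply (is_RInt_gen_unique (V := R_CompleteNormedModule)) in HF'.
  rewrite HF in HF'. lra.
Qed.

(** After factoring out [exp m] at the mean point, the tangent inequality [1 + y <= exp y] at both
    points suffices, since the deviations from [m] average to zero. *)
Lemma exp_convex (th p q : R) : 0 <= th <= 1 ->
  exp (th * p + (1 - th) * q) <= th * exp p + (1 - th) * exp q.
Proof.
  intros Hth. set (m := th * p + (1 - th) * q).
  replace (exp p) with (exp m * exp (p - m)) by (rewrite <- exp_plus; f_equal; ring).
  replace (exp q) with (exp m * exp (q - m)) by (rewrite <- exp_plus; f_equal; ring).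
  pose proof (exp_ineq1_le (p - m)). pose proof (exp_ineq1_le (q - m)).
  assert (1 <= th * exp (p - m) + (1 - th) * exp (q - m)).
  { apply Rle_trans with (th * (1 + (p - m)) + (1 - th) * (1 + (q - m))).
    - right; unfold m; ring.
    - apply Rplus_le_compat; apply Rmult_le_compat_l; lra. }
  pose proof (exp_pos m). nra.
Qed.

(* Hölder: integrate the convexity inequality of [exp] for the two normalised integrands. *)
Lemma ln_Gamma_convex (th x y : R) : 0 <= th <= 1 -> 0 < x -> 0 < y ->
  ln (Gamma (th * x + (1 - th) * y)) <= th * ln (Gamma x) + (1 - th) * ln (Gamma y).
Proof.
  intros Hth Hx Hy.
  assert (Hz : 0 < th * x + (1 - th) * y).
  { destruct (Rle_lt_dec th (1 / 2)); nra. }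
  set (z := th * x + (1 - th) * y) in *.
  set (m := th * ln (Gamma x) + (1 - th) * ln (Gamma y)).
  destruct (gfun_RInt_gen x Hx) as [Ix Px], (gfun_RInt_gen y Hy) as [Iy Py],
    (gfun_RInt_gen z Hz) as [Iz Pz].
  (* With each integrand divided by its own integral, the right-hand side is just
     [th + (1 - th) = 1]. *)
  assert (Hle : exp (- m) * Gamma z <= th * / Gamma x * Gamma x + (1 - th) * / Gamma y * Gamma y).
  { apply Rle_trans with (1 := Rle_abs _).
    apply (RInt_gen_norm (V := R_CompleteNormedModule) (Fa := at_right 0) (Fb := Rbar_locally p_infty)
      (fun u => exp (- m) * gfun z u)
      (fun u => th * / Gamma x * gfun x u + (1 - th) * / Gamma y * gfun y u)).
    - apply (filter_prod_interval (fun a b => a <= b) 1 1); [lra | intros; lra].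
    - apply (filter_prod_interval (fun a b => forall u, a <= u <= b ->
        Rabs (exp (- m) * gfun z u) <= th * / Gamma x * gfun x u + (1 - th) * / Gamma y * gfun y u)
        1 1); [lra | intros a b Ha Hb u Hu].
      rewrite Rabs_right by (apply Rle_ge, Rmult_le_pos; left; [apply exp_pos | apply gfun_pos]).
      rewrite <- (exp_ln (/ Gamma x)), <- (exp_ln (/ Gamma y)), !ln_Rinv
        by (try apply Rinv_0_lt_compat; assumption).
      unfold gfun, Rpower. rewrite !Rmult_assoc, <- !exp_plus.
      apply Rle_trans with (2 := exp_convex th _ _ Hth).
      right; f_equal. unfold m, z. ring.
    - apply (is_RInt_gen_scal (V := R_NormedModule)), Iz.
    - apply (is_RInt_gen_plus (V := R_NormedModule));
        apply (is_RInt_gen_scal (V := R_NormedModule)); assumption. }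
  rewrite !Rmult_assoc, !Rinv_l in Hle by lra.
  rewrite exp_Ropp in Hle.
  assert (Gamma z <= exp m).
  { pose proof (exp_pos m). apply Rmult_le_reg_l with (/ exp m); [apply Rinv_0_lt_compat; lra | ].
    rewrite Rinv_l; lra. }
  rewrite <- (ln_exp m). apply ln_le; assumption.
Qed.

(** * The digamma function *)

Lemma mvt_pos (f f' : R -> R) (x y : R) :
  (forall z, 0 < z -> is_derive f z (f' z)) -> 0 < x <= y ->
  exists z, x <= z <= y /\ f y - f x = f' z * (y - x).
Proof.
  intros Hf Hxy. destruct (MVT_gen f x y f') as (z & Hz & Heq).
  - intros z Hz. rewrite Rmin_left in Hz by lra. apply Hf; lra.
  - intros z Hz. rewrite Rmin_left in Hz by lra.
    apply continuity_pt_filterlim, (ex_derive_continuous (V := R_NormedModule)).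
    exists (f' z). apply Hf; lra.
  - rewrite Rmin_left, Rmax_right in Hz by lra. exists z; auto.
Qed.

Lemma is_derive_0_const (f : R -> R) (x y : R) :
  (forall z, 0 < z -> is_derive f z 0) -> 0 < x -> 0 < y -> f x = f y.
Proof.
  intros Hf Hx Hy. destruct (Rle_lt_dec x y) as [H | H].
  - destruct (mvt_pos f (fun _ => 0) x y Hf) as (z & _ & Hz); lra.
  - destruct (mvt_pos f (fun _ => 0) y x Hf) as (z & _ & Hz); lra.
Qed.

(** For the antiderivative [P] of [digamma0], the defect [P (x + 1) - P x - ln x] has derivative
    zero by [digamma0_shift]; a linear term removes this constant. *)
Lemma log_difference_solution : exists (c : R) (g : R -> R),
  (forall x, 0 < x -> is_derive g x (digamma0 x + c)) /\
  (forall x, 0 < x -> g (x + 1) = g x + ln x).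
Proof.
  set (P := fun x => RInt digamma0 1 x).
  assert (HP : forall x, 0 < x -> is_derive P x (digamma0 x)).
  { intros x Hx. apply is_derive_RInt_pos; [ | lra | exact Hx].
    intros u Hu. apply (ex_derive_continuous (V := R_NormedModule)).
    eexists; apply digamma0_derive, Hu. }
  set (Q := fun x => P (x + 1) - P x - ln x).
  assert (HQ : forall x, 0 < x -> is_derive Q x 0).
  { intros x Hx. replace 0 with (digamma0 (x + 1) - digamma0 x - / x)
      by (rewrite digamma0_shift by exact Hx; ring).
    apply (is_derive_minus (V := R_NormedModule) (fun x => P (x + 1) - P x) ln);
      [apply (is_derive_minus (V := R_NormedModule) (fun x => P (x + 1)) P) | ].
    - replace (digamma0 (x + 1)) with (1 * digamma0 (x + 1)) by ring.
      apply (is_derive_comp P (fun x => x + 1)).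
      + apply HP; lra.
      + auto_derive; [exact I | ring].
    - apply HP, Hx.
    - apply is_derive_Reals, derivable_pt_lim_ln, Hx. }
  exists (- Q 1), (fun x => P x + - Q 1 * x). split.
  - intros x Hx. apply (is_derive_plus (V := R_NormedModule) P (fun x => - Q 1 * x)).
    + apply HP, Hx.
    + auto_derive; [exact I | ring].
  - intros x Hx. rewrite (is_derive_0_const Q 1 x HQ) by lra. unfold Q. ring.
Qed.

Lemma digamma0_incr (x y : R) : 0 < x <= y -> digamma0 x <= digamma0 y.
Proof.
  intros Hxy. destruct (mvt_pos digamma0 (hurwitz 2) x y digamma0_derive Hxy) as (z & Hz & Heq).
  assert (0 <= hurwitz 2 z).
  { apply Rle_trans with (/ z); [left; apply Rinv_0_lt_compat; lra | apply hurwitz2_bounds; lra]. }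
  assert (0 <= hurwitz 2 z * (y - x)) by (apply Rmult_le_pos; lra). lra.
Qed.

Lemma ln_Gamma_shift (x : R) : 0 < x -> ln (Gamma (x + 1)) = ln (Gamma x) + ln x.
Proof.
  intros Hx. rewrite Gamma_shift, ln_mult by (try apply Gamma_pos; exact Hx). ring.
Qed.

(** Log-convexity between [x] and [x + 1] bounds the increment above, and between [x - 1] and
    [x + h] below. The upper bound is relaxed from [ln x] to [ln (x + 1)] to match the one available
    for [g]. *)
Lemma ln_Gamma_increment (x h : R) : 1 < x -> 0 <= h <= 1 ->
  h * ln (x - 1) <= ln (Gamma (x + h)) - ln (Gamma x) <= h * ln (x + 1).
Proof.
  intros Hx Hh. split.
  (* The weight [h / (1 + h)] is the one that makes [x] the mean of [x - 1] and [x + h]. *)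
  - pose proof (ln_Gamma_convex (h / (1 + h)) (x - 1) (x + h)) as Hc.
    replace (h / (1 + h) * (x - 1) + (1 - h / (1 + h)) * (x + h)) with x in Hc by (field; lra).
    assert (Ht : 0 <= h / (1 + h) <= 1).
    { split.
      - apply Rmult_le_pos; [lra | left; apply Rinv_0_lt_compat; lra].
      - apply Rmult_le_reg_r with (1 + h); [lra | ].
        unfold Rdiv; rewrite Rmult_assoc, Rinv_l; lra. }
    specialize (Hc Ht ltac:(lra) ltac:(lra)).
    pose proof (ln_Gamma_shift (x - 1) ltac:(lra)) as Hs.
    replace (x - 1 + 1) with x in Hs by ring.
    apply (Rmult_le_compat_l (1 + h)) in Hc; [ | lra].
    replace ((1 + h) * (h / (1 + h) * ln (Gamma (x - 1)) + (1 - h / (1 + h)) * ln (Gamma (x + h))))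
      with (h * ln (Gamma (x - 1)) + ln (Gamma (x + h))) in Hc by (field; lra).
    nra.
  - pose proof (ln_Gamma_convex h (x + 1) x Hh ltac:(lra) ltac:(lra)) as Hc.
    replace (h * (x + 1) + (1 - h) * x) with (x + h) in Hc by ring.
    rewrite ln_Gamma_shift in Hc by lra.
    assert (ln x <= ln (x + 1)) by (apply ln_le; lra).
    nra.
Qed.

(** The derivative of [g] increases, so its mean over [[x, x + h]] lies between its means over
    [[x - 1, x]] and [[x + 1, x + 2]], which the functional equation evaluates. *)
Lemma log_difference_increment (c : R) (g : R -> R) (x h : R) :
  (forall x, 0 < x -> is_derive g x (digamma0 x + c)) ->
  (forall x, 0 < x -> g (x + 1) = g x + ln x) ->
  1 < x -> 0 <= h <= 1 ->
  h * ln (x - 1) <= g (x + h) - g x <= h * ln (x + 1).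
Proof.
  intros Hd Hs Hx Hh.
  destruct (mvt_pos g _ x (x + h) Hd ltac:(lra)) as (z & Hz & ->).
  destruct (mvt_pos g _ (x - 1) x Hd ltac:(lra)) as (z0 & Hz0 & H0).
  destruct (mvt_pos g _ (x + 1) (x + 1 + 1) Hd ltac:(lra)) as (z1 & Hz1 & H1).
  rewrite Hs in H1 by lra.
  pose proof (Hs (x - 1) ltac:(lra)) as H2. replace (x - 1 + 1) with x in H2 by ring.
  pose proof (digamma0_incr z0 z ltac:(lra)).
  pose proof (digamma0_incr z z1 ltac:(lra)).
  replace (x + h - x) with h by ring. rewrite (Rmult_comm _ h).
  split; apply Rmult_le_compat_l; lra.
Qed.

Lemma ln_gap (x : R) : 1 < x -> ln (x + 1) - ln (x - 1) <= 2 / (x - 1).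
Proof.
  intros Hx.
  replace (ln (x + 1)) with (ln (x - 1) + ln (1 + 2 / (x - 1))).
  - pose proof (exp_ineq1_le (ln (1 + 2 / (x - 1)))) as H.
    rewrite exp_ln in H; [lra | ].
    assert (0 < 2 / (x - 1)) by (apply Rdiv_lt_0_compat; lra). lra.
  - rewrite <- ln_mult; [f_equal; field; lra | lra | ].
    assert (0 < 2 / (x - 1)) by (apply Rdiv_lt_0_compat; lra). lra.
Qed.

(* Bohr-Mollerup: two solutions of g (x + 1) = g x + ln x whose increments are squeezed by
   those of ln differ by a function that is 1-periodic and has vanishing increments. *)
Lemma ln_Gamma_derive : exists c, forall x, 0 < x ->
  is_derive (fun y => ln (Gamma y)) x (digamma0 x + c).
Proof.
  destruct log_difference_solution as (c & g & Hd & Hs).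
  exists c.
  set (D := fun y => ln (Gamma y) - g y).
  assert (Hper : forall x n, 0 < x -> D (x + INR n) = D x).
  { intros x n Hx. induction n as [ | n IH].
    - simpl INR. rewrite Rplus_0_r. reflexivity.
    - rewrite S_INR, <- Rplus_assoc, <- IH. pose proof (pos_INR n).
      unfold D. rewrite ln_Gamma_shift, Hs by lra. ring. }
  assert (Hinc : forall x h, 1 < x -> 0 <= h <= 1 -> Rabs (D (x + h) - D x) <= 2 / (x - 1)).
  { intros x h Hx Hh.
    pose proof (ln_Gamma_increment x h Hx Hh).
    pose proof (log_difference_increment c g x h Hd Hs Hx Hh).
    pose proof (ln_gap x Hx).
    assert (h * (ln (x + 1) - ln (x - 1)) <= 1 * (ln (x + 1) - ln (x - 1))).
    { apply Rmult_le_compat_r; [ | lra].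
      assert (ln (x - 1) <= ln (x + 1)) by (apply ln_le; lra). lra. }
    unfold D. apply Rabs_le. lra. }
  (* Periodicity carries the increment to [x + n], where it is at most [2 / (x + n - 1)]; for large
     [n] this excludes a nonzero value. *)
  assert (Hconst : forall x h, 0 < x -> 0 <= h <= 1 -> D (x + h) = D x).
  { intros x h Hx Hh. apply Rminus_diag_uniq.
    destruct (Req_dec (D (x + h) - D x) 0) as [H0 | H0]; [exact H0 | exfalso].
    apply Rabs_pos_lt in H0. set (e := Rabs (D (x + h) - D x)) in *.
    destruct (INR_unbounded (1 + 2 / e)) as [n Hn].
    assert (0 < 2 / e) by (apply Rdiv_lt_0_compat; lra).
    pose proof (Hinc (x + INR n) h ltac:(lra) Hh) as Hi.
    replace (x + INR n + h) with (x + h + INR n) in Hi by ring.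
    rewrite !Hper in Hi by lra. fold e in Hi.
    apply (Rmult_le_compat_r (x + INR n - 1)) in Hi; [ | lra].
    replace (2 / (x + INR n - 1) * (x + INR n - 1)) with 2 in Hi by (field; lra).
    assert (e * (2 / e) < e * (x + INR n - 1)) by (apply Rmult_lt_compat_l; lra).
    replace (e * (2 / e)) with 2 in H1 by (field; lra). lra. }
  assert (Hloc : forall x y, 0 < x -> 0 < y -> x - 1 < y < x + 1 -> D y = D x).
  { intros x y Hx Hy Hxy. destruct (Rle_lt_dec x y) as [H | H].
    - replace y with (x + (y - x)) by ring. apply Hconst; lra.
    - symmetry. replace x with (y + (x - y)) by ring. apply Hconst; lra. }
  intros x Hx.
  apply (is_derive_ext_loc (fun y => g y + D x)).
  - assert (Hl : locally x (fun y => 0 < y /\ x - 1 < y /\ y < x + 1)).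
    { apply filter_and; [apply locally_pos, Hx | apply filter_and].
      - apply (open_gt (x - 1)); lra.
      - apply (open_lt (x + 1)); lra. }
    revert Hl; apply filter_imp. intros y (Hy & Hy1 & Hy2).
    rewrite <- (Hloc x y Hx Hy (conj Hy1 Hy2)). unfold D.
    apply Rplus_minus.
  - replace (digamma0 x + c) with ((digamma0 x + c) + 0) by ring.
    apply (is_derive_plus (V := R_NormedModule) g (fun _ => D x)); [apply Hd, Hx | ].
    apply (is_derive_const (V := R_NormedModule)).
Qed.

(** Writing [Gamma] as [exp (ln Gamma)] near [x] identifies the quotient defining [psi] with the
    logarithmic derivative. The constant [c] is minus Euler's constant. *)
Lemma psi_digamma0 : exists c, forall x, 0 < x ->
  psi x = digamma0 x + c /\ is_derive (fun y => ln (Gamma y)) x (psi x).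
Proof.
  destruct ln_Gamma_derive as [c Hc]. exists c. intros x Hx.
  assert (Hpsi : psi x = digamma0 x + c).
  { assert (HG : is_derive Gamma x (Gamma x * (digamma0 x + c))).
    { apply (is_derive_ext_loc (fun y => exp (ln (Gamma y)))).
      - generalize (locally_pos x Hx); apply filter_imp.
        intros y Hy. apply exp_ln, Gamma_pos, Hy.
      - replace (Gamma x * (digamma0 x + c)) with ((digamma0 x + c) * exp (ln (Gamma x)))
          by (rewrite exp_ln by (apply Gamma_pos, Hx); ring).
        apply (is_derive_comp exp (fun y => ln (Gamma y))).
        + apply is_derive_Reals, derivable_pt_lim_exp.
        + apply Hc, Hx. }
    unfold psi. rewrite (is_derive_unique _ _ _ HG). field.
    apply Rgt_not_eq, Gamma_pos, Hx. }
  split; [exact Hpsi | rewrite Hpsi; apply Hc, Hx].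
Qed.

Lemma ln_Gamma_derive_psi (x : R) : 0 < x -> is_derive (fun y => ln (Gamma y)) x (psi x).
Proof. destruct psi_digamma0 as [c Hc]. apply Hc. Qed.

Lemma psi_derive (x : R) : 0 < x -> is_derive psi x (hurwitz 2 x).
Proof.
  intros Hx. destruct psi_digamma0 as [c Hc].
  apply (is_derive_ext_loc (fun y => digamma0 y + c)).
  - generalize (locally_pos x Hx); apply filter_imp. intros y Hy. symmetry; apply Hc, Hy.
  - replace (hurwitz 2 x) with (hurwitz 2 x + 0) by ring.
    apply (is_derive_plus (V := R_NormedModule) digamma0 (fun _ => c)).
    + apply digamma0_derive, Hx.
    + apply (is_derive_const (V := R_NormedModule)).
Qed.

Lemma psi_shift (x : R) : 0 < x -> psi (x + 1) = psi x + / x.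
Proof.
  intros Hx. destruct psi_digamma0 as [c Hc].
  destruct (Hc x Hx) as [-> _], (Hc (x + 1)) as [-> _]; [lra | ].
  rewrite digamma0_shift by exact Hx. ring.
Qed.

Lemma psi_incr (x y : R) : 0 < x <= y -> psi x <= psi y.
Proof.
  intros Hxy. destruct psi_digamma0 as [c Hc].
  destruct (Hc x) as [-> _]; [lra | ]. destruct (Hc y) as [-> _]; [lra | ].
  pose proof (digamma0_incr x y Hxy). lra.
Qed.

(** * Completely monotonic derivatives *)

(** A chain of explicit derivative functions on [I]; unlike [ex_derive_n] it passes through products
    and [exp] by a plain induction. *)
Fixpoint smooth_upto (I : R -> Prop) (n : nat) (f : R -> R) : Prop :=
  match n with
  | O => True
  | S m => exists f', (forall x, I x -> is_derive f x (f' x)) /\ smooth_upto I m f'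
  end.

Lemma smooth_upto_pred (I : R -> Prop) (n : nat) (f : R -> R) :
  smooth_upto I (S n) f -> smooth_upto I n f.
Proof.
  revert f; induction n as [ | n IH]; intros f [f' [H1 H2]]; simpl; [exact Logic.I | ].
  exists f'; split; [exact H1 | apply IH, H2].
Qed.

Lemma smooth_upto_plus (I : R -> Prop) (n : nat) (f g : R -> R) :
  smooth_upto I n f -> smooth_upto I n g -> smooth_upto I n (fun x => f x + g x).
Proof.
  revert f g; induction n as [ | n IH]; intros f g; [intros; exact Logic.I | ].
  intros [f' [Hf Hf']] [g' [Hg Hg']].
  exists (fun x => f' x + g' x); split; [ | apply IH; assumption].
  intros x Hx. apply (is_derive_plus (V := R_NormedModule) f g); auto.
Qed.

Lemma smooth_upto_mult (I : R -> Prop) (n : nat) (f g : R -> R) :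
  smooth_upto I n f -> smooth_upto I n g -> smooth_upto I n (fun x => f x * g x).
Proof.
  revert f g; induction n as [ | n IH]; intros f g Hf Hg; [exact Logic.I | ].
  pose proof (smooth_upto_pred _ _ _ Hf). pose proof (smooth_upto_pred _ _ _ Hg).
  destruct Hf as [f' [Hf Hf']], Hg as [g' [Hg Hg']].
  exists (fun x => f' x * g x + f x * g' x); split.
  - intros x Hx. apply (is_derive_mult f g); auto. intros; apply Rmult_comm.
  - apply smooth_upto_plus; apply IH; assumption.
Qed.

Lemma smooth_upto_const (I : R -> Prop) (n : nat) (c : R) : smooth_upto I n (fun _ => c).
Proof.
  revert c; induction n as [ | n IH]; intros c; [exact Logic.I | ].
  exists (fun _ => 0); split; [ | apply IH].
  intros x _. apply (is_derive_const (V := R_NormedModule)).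
Qed.

Lemma smooth_upto_exp (I : R -> Prop) (n : nat) (f : R -> R) :
  smooth_upto I n f -> smooth_upto I n (fun x => exp (f x)).
Proof.
  revert f; induction n as [ | n IH]; intros f Hf; [exact Logic.I | ].
  pose proof (smooth_upto_pred _ _ _ Hf). destruct Hf as [f' [Hf Hf']].
  exists (fun x => f' x * exp (f x)); split.
  - intros x Hx. apply (is_derive_comp exp f); [ | auto].
    apply is_derive_Reals, derivable_pt_lim_exp.
  - apply smooth_upto_mult; auto.
Qed.

Lemma smooth_upto_ex_derive_n (I : R -> Prop) (n : nat) (f : R -> R) (x : R) :
  (forall x, I x -> locally x I) -> smooth_upto I n f -> I x -> ex_derive_n f n x.
Proof.
  intros HI. revert f x; induction n as [ | n IH]; intros f x; [intros; exact Logic.I | ].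
  intros [f' [Hf Hf']] Hx.
  destruct n as [ | n]; [exists (f' x); apply Hf, Hx | ].
  apply (ex_derive_ext_loc (Derive_n f' n)); [ | apply (IH f' x Hf' Hx)].
  generalize (HI x Hx); apply filter_imp. intros y Hy.
  (* [Derive_n] adds derivatives on the outside while the chain begins with [f']; the composition
     law moves the first derivative inside. *)
  change (S n) with (1 + n)%nat. rewrite Nat.add_comm, <- (Derive_n_comp f n 1).
  apply Derive_n_ext_loc.
  generalize (HI y Hy); apply filter_imp. intros z Hz.
  symmetry; apply is_derive_unique, Hf, Hz.
Qed.

(* [D k] plays the role of [(-1)^(k-1) / (k-1)! * F^(k)], as [x^(-k)] does for [F = ln]. *)
Definition derivative_ladder (I : R -> Prop) (F : R -> R) (D : nat -> R -> R) : Prop :=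
  (forall x, I x -> is_derive F x (D 1%nat x)) /\
  (forall k x, (1 <= k)%nat -> I x -> is_derive (D k) x (- INR k * D (S k) x)).

Lemma ladder_Derive_n (I : R -> Prop) (F : R -> R) (D : nat -> R -> R) (j : nat) (x : R) :
  (forall x, I x -> locally x I) -> derivative_ladder I F D -> I x ->
  Derive_n F (S j) x = (-1) ^ j * INR (fact j) * D (S j) x.
Proof.
  intros HI [HF HD]. revert x; induction j as [ | j IH]; intros x Hx.
  - replace (Derive_n F 1 x) with (D 1%nat x) by (symmetry; apply is_derive_unique, HF, Hx).
    simpl. ring.
  - change (Derive_n F (S (S j)) x) with (Derive (Derive_n F (S j)) x).
    apply is_derive_unique.
    apply (is_derive_ext_loc (fun y => (-1) ^ j * INR (fact j) * D (S j) y)).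
    + generalize (HI x Hx); apply filter_imp. intros y Hy. symmetry; apply IH, Hy.
    + replace ((-1) ^ S j * INR (fact (S j)) * D (S (S j)) x)
        with ((-1) ^ j * INR (fact j) * (- INR (S j) * D (S (S j)) x)).
      * apply is_derive_scal, HD; [lia | exact Hx].
      * rewrite fact_simpl, mult_INR. simpl pow. ring.
Qed.

Lemma ladder_smooth (I : R -> Prop) (F : R -> R) (D : nat -> R -> R) (n : nat) :
  derivative_ladder I F D -> smooth_upto I n F.
Proof.
  intros [HF HD].
  assert (Hk : forall n k, (1 <= k)%nat -> smooth_upto I n (D k)).
  { clear n. induction n as [ | n IH]; intros k Hk; [exact Logic.I | ].
    exists (fun x => - INR k * D (S k) x); split; [auto | ].
    apply smooth_upto_mult; [apply smooth_upto_const | apply IH; lia]. }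
  destruct n as [ | n]; [exact Logic.I | ].
  exists (D 1%nat); auto.
Qed.

(** The sign [(-1) ^ k] meets the sign [(-1) ^ (k - 1)] of the ladder, leaving [-1] times a positive
    factorial; positivity and smoothness of [h] come from its form [exp F]. *)
Lemma log_cm_iff_ladder (I : R -> Prop) (h F : R -> R) (D : nat -> R -> R) :
  (forall x, I x -> locally x I) -> (forall x, I x -> h x = exp (F x)) ->
  derivative_ladder I F D ->
  (log_completely_monotonic h I <->
   forall k x, (1 <= k)%nat -> I x -> D k x <= 0).
Proof.
  intros HI Hh HL.
  assert (Hloc : forall x, I x -> locally x (fun y => exp (F y) = h y)).
  { intros x Hx. generalize (HI x Hx); apply filter_imp. intros y Hy. symmetry; auto. }
  assert (Heq : forall k x, (1 <= k)%nat -> I x ->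
    (-1) ^ k * Derive_n (fun y => ln (h y)) k x = - (INR (fact (k - 1)) * D k x)).
  { intros [ | j] x Hk Hx; [lia | ].
    rewrite (Derive_n_ext_loc _ F).
    - rewrite (ladder_Derive_n I F D j x HI HL Hx). simpl Nat.sub. rewrite Nat.sub_0_r.
      rewrite <- !Rmult_assoc, <- pow_add.
      replace (S j + j)%nat with (S (2 * j)) by lia. rewrite pow_1_odd. ring.
    - generalize (Hloc x Hx); apply filter_imp. intros y <-. apply ln_exp. }
  assert (Hfact : forall k, 0 < INR (fact k)) by (intros; apply INR_fact_lt_0).
  split.
  - intros (_ & _ & Hcm) k x Hk Hx. specialize (Hcm k x Hx Hk).
    rewrite Heq in Hcm by assumption. specialize (Hfact (k - 1)%nat). nra.
  - intros HD. split; [ | split].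
    + intros x Hx. rewrite Hh by exact Hx. apply exp_pos.
    + intros k x Hx. apply (ex_derive_n_ext_loc (fun y => exp (F y))); [apply Hloc, Hx | ].
      apply (smooth_upto_ex_derive_n I); [exact HI | | exact Hx].
      apply smooth_upto_exp, (ladder_smooth I F D), HL.
    + intros k x Hx Hk. rewrite Heq by assumption.
      specialize (HD k x Hk Hx). specialize (Hfact (k - 1)%nat). nra.
Qed.

Lemma log_cm_inv_iff_ladder (I : R -> Prop) (h F : R -> R) (D : nat -> R -> R) :
  (forall x, I x -> locally x I) -> (forall x, I x -> h x = exp (F x)) ->
  derivative_ladder I F D ->
  (log_completely_monotonic (fun x => / h x) I <->
   forall k x, (1 <= k)%nat -> I x -> 0 <= D k x).
Proof.
  intros HI Hh [HF HD].
  rewrite (log_cm_iff_ladder I _ (fun x => - F x) (fun k x => - D k x)).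
  - split; intros H k x Hk Hx; specialize (H k x Hk Hx); lra.
  - exact HI.
  - intros x Hx. rewrite exp_Ropp, Hh by exact Hx. reflexivity.
  - split.
    + intros x Hx. apply (is_derive_opp (V := R_NormedModule) F), HF, Hx.
    + intros k x Hk Hx.
      replace (- INR k * - D (S k) x) with (- (- INR k * D (S k) x)) by ring.
      apply (is_derive_opp (V := R_NormedModule) (D k)), HD; assumption.
Qed.

(** * Unit steps, limits at infinity and polygamma functions *)

(** A negative value would bound [E (x + n)] away from its limit [0] for all [n]. *)
Lemma nonneg_of_step_decreasing (lo : R) (E : R -> R) (x : R) :
  (forall y, lo < y -> E (y + 1) <= E y) -> is_lim E p_infty 0 -> lo < x -> 0 <= E x.
Proof.
  intros Hstep Hlim Hx.
  assert (Hn : forall n, E (x + INR n) <= E x).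
  { induction n as [ | n IH].
    - simpl INR. rewrite Rplus_0_r. lra.
    - rewrite S_INR, <- Rplus_assoc. pose proof (pos_INR n).
      apply Rle_trans with (2 := IH). apply Hstep. lra. }
  apply Rnot_lt_le. intros Hneg.
  apply is_lim_spec in Hlim.
  destruct (Hlim (mkposreal (- E x) ltac:(lra))) as [M HM]. simpl in HM.
  destruct (INR_unbounded (M - x)) as [n Hn'].
  specialize (HM (x + INR n) ltac:(lra)). specialize (Hn n).
  apply Rabs_def2 in HM. lra.
Qed.

Lemma is_lim_0_of_bound (E : R -> R) (c C : R) :
  (forall x, 1 <= x + c -> Rabs (E x) <= C / (x + c)) -> is_lim E p_infty 0.
Proof.
  intros H. apply is_lim_spec. intros eps. pose proof (cond_pos eps).
  exists (Rmax (1 - c) (Rabs C / eps - c)). intros x Hx.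
  pose proof (Rmax_l (1 - c) (Rabs C / eps - c)). pose proof (Rmax_r (1 - c) (Rabs C / eps - c)).
  rewrite Rminus_0_r. apply Rle_lt_trans with (1 := H x ltac:(lra)).
  apply Rmult_lt_reg_r with (x + c); [lra | ].
  unfold Rdiv at 1. rewrite Rmult_assoc, Rinv_l, Rmult_1_r by lra.
  apply Rle_lt_trans with (1 := Rle_abs C).
  apply Rmult_lt_reg_r with (/ eps); [apply Rinv_0_lt_compat; lra | ].
  replace (eps * (x + c) * / eps) with (x + c) by (field; lra).
  unfold Rdiv in *; lra.
Qed.

(* [polygamma k = (-1)^k / (k-1)! * psi^(k-1)], which behaves like [x^(-k)] both under
   differentiation and under the shift [x -> x + 1]. *)
Definition polygamma (k : nat) (x : R) : R :=
  match k with 1%nat => - psi x | _ => hurwitz k x end.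

Lemma polygamma_derive (k : nat) (x : R) : (1 <= k)%nat -> 0 < x ->
  is_derive (polygamma k) x (- INR k * polygamma (S k) x).
Proof.
  intros Hk Hx. destruct k as [ | [ | k]]; [lia | | apply hurwitz_derive; [lia | exact Hx]].
  replace (- INR 1 * polygamma 2 x) with (- hurwitz 2 x) by (simpl; ring).
  apply (is_derive_opp (V := R_NormedModule) psi), psi_derive, Hx.
Qed.

Lemma polygamma_shift (k : nat) (x : R) : (1 <= k)%nat -> 0 < x ->
  polygamma k (x + 1) = polygamma k x - (/ x) ^ k.
Proof.
  intros Hk Hx. destruct k as [ | [ | k]]; [lia | | apply hurwitz_shift; [lia | exact Hx]].
  simpl. rewrite psi_shift by exact Hx. ring.
Qed.

Lemma is_lim_inv_pow (k : nat) (c : R) : (1 <= k)%nat ->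
  is_lim (fun x => (/ (x + c)) ^ k) p_infty 0.
Proof.
  intros Hk. apply is_lim_0_of_bound with c 1. intros x Hx.
  assert (0 < / (x + c) <= 1).
  { split; [apply Rinv_0_lt_compat; lra | rewrite <- Rinv_1; apply Rinv_le_contravar; lra]. }
  rewrite Rabs_right by (apply Rle_ge, pow_le; lra).
  destruct k as [ | k]; [lia | ]. simpl. unfold Rdiv. rewrite Rmult_1_l.
  rewrite <- (Rmult_1_r (/ (x + c))) at 3. apply Rmult_le_compat_l; [lra | ].
  rewrite <- (pow1 k). apply pow_incr. lra.
Qed.

Lemma is_lim_hurwitz (k : nat) (c : R) : (2 <= k)%nat ->
  is_lim (fun x => hurwitz k (x + c)) p_infty 0.
Proof.
  intros Hk. apply is_lim_0_of_bound with c 2. intros x Hx.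
  destruct (hurwitz_decay k (x + c) Hk Hx). rewrite Rabs_right; lra.
Qed.

Lemma psi_increment (x d : R) : 0 < x -> 0 <= d ->
  exists z, x <= z <= x + d /\ psi (x + d) - psi x = d * hurwitz 2 z.
Proof.
  intros Hx Hd. destruct (mvt_pos psi (hurwitz 2) x (x + d) psi_derive) as (z & Hz & Heq); [lra | ].
  exists z; split; [exact Hz | ]. rewrite Heq. ring.
Qed.

(** For [k = 1] the two [psi] terms diverge separately, so the mean value theorem bounds their
    difference by a decaying value of [hurwitz 2]. *)
Lemma is_lim_polygamma_diff (k : nat) (s t : R) : (1 <= k)%nat -> s <= t ->
  is_lim (fun x => polygamma k (x + s) - polygamma k (x + t)) p_infty 0.
Proof.
  intros Hk Hst. destruct k as [ | [ | k]]; [lia | | ].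
  - apply is_lim_0_of_bound with s ((t - s) * 2). intros x Hx. simpl.
    destruct (psi_increment (x + s) (t - s)) as (z & Hz & Heq); [lra | lra | ].
    replace (x + s + (t - s)) with (x + t) in Heq by ring.
    replace (- psi (x + s) - - psi (x + t)) with (psi (x + t) - psi (x + s)) by ring.
    rewrite Heq.
    destruct (hurwitz_decay 2 z) as [H1 H2]; [lia | lra | ].
    rewrite Rabs_right by (apply Rle_ge, Rmult_le_pos; lra).
    unfold Rdiv. rewrite Rmult_assoc. apply Rmult_le_compat_l; [lra | ].
    apply Rle_trans with (1 := H2). unfold Rdiv. apply Rmult_le_compat_l; [lra | ].
    apply Rinv_le_contravar; lra.
  - simpl polygamma. replace (Finite 0) with (Finite (0 - 0)) by (f_equal; ring).
    apply is_lim_minus'; apply is_lim_hurwitz; lia.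
Qed.

(** * The function [H] *)

Lemma inv_pow_antitone (k : nat) (x y : R) : 0 < x <= y -> 0 <= (/ y) ^ k <= (/ x) ^ k.
Proof.
  intros Hxy. assert (0 < / y) by (apply Rinv_0_lt_compat; lra). split.
  - apply pow_le; lra.
  - apply pow_incr; split; [lra | apply Rinv_le_contravar; lra].
Qed.

(* Induction on [k], jointly for the sums and the differences of the [k]-th powers of
   [p = 1 / (c - w)] and [q = 1 / (c + w)]; both [p + q] and [(p - q) / w] increase with [w]. *)
Lemma symmetric_difference_ratio (c w1 w2 : R) (k : nat) :
  0 <= w2 <= w1 -> w1 < c ->
  w1 * ((/ (c - w2)) ^ k - (/ (c + w2)) ^ k) <= w2 * ((/ (c - w1)) ^ k - (/ (c + w1)) ^ k).
Proof.
  intros Hw Hc.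
  set (p1 := / (c - w1)). set (q1 := / (c + w1)). set (p2 := / (c - w2)). set (q2 := / (c + w2)).
  assert (Hq1 : 0 < q1) by (apply Rinv_0_lt_compat; lra).
  assert (Hq2 : 0 < q2) by (apply Rinv_0_lt_compat; lra).
  assert (Hp1 : 0 < p1) by (apply Rinv_0_lt_compat; lra).
  assert (Hp2 : 0 < p2) by (apply Rinv_0_lt_compat; lra).
  assert (Hd1 : 0 < / (c ^ 2 - w1 ^ 2)) by (apply Rinv_0_lt_compat; nra).
  assert (Hd12 : 0 < / (c ^ 2 - w2 ^ 2) <= / (c ^ 2 - w1 ^ 2)).
  { split; [apply Rinv_0_lt_compat; nra | apply Rinv_le_contravar; nra]. }
  assert (Es1 : p1 + q1 = 2 * c * / (c ^ 2 - w1 ^ 2)) by (unfold p1, q1; field; split; [ | split]; nra).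
  assert (Es2 : p2 + q2 = 2 * c * / (c ^ 2 - w2 ^ 2)) by (unfold p2, q2; field; split; [ | split]; nra).
  assert (Ed1 : p1 - q1 = 2 * w1 * / (c ^ 2 - w1 ^ 2)) by (unfold p1, q1; field; split; [ | split]; nra).
  assert (Ed2 : p2 - q2 = 2 * w2 * / (c ^ 2 - w2 ^ 2)) by (unfold p2, q2; field; split; [ | split]; nra).
  assert (Hs : p2 + q2 <= p1 + q1) by (rewrite Es1, Es2; apply Rmult_le_compat_l; lra).
  assert (Hd2 : 0 <= p2 - q2) by (rewrite Ed2; apply Rmult_le_pos; lra).
  assert (Hd : p2 - q2 <= p1 - q1) by (rewrite Ed1, Ed2; apply Rmult_le_compat; lra).
  assert (Hwd : w1 * (p2 - q2) <= w2 * (p1 - q1)).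
  { rewrite Ed1, Ed2.
    replace (w1 * (2 * w2 * / (c ^ 2 - w2 ^ 2))) with (2 * w1 * w2 * / (c ^ 2 - w2 ^ 2)) by ring.
    replace (w2 * (2 * w1 * / (c ^ 2 - w1 ^ 2))) with (2 * w1 * w2 * / (c ^ 2 - w1 ^ 2)) by ring.
    apply Rmult_le_compat_l; [nra | lra]. }
  assert (Hind : 0 <= p2 ^ k - q2 ^ k <= p1 ^ k - q1 ^ k /\
                 0 <= p2 ^ k + q2 ^ k <= p1 ^ k + q1 ^ k /\
                 w1 * (p2 ^ k - q2 ^ k) <= w2 * (p1 ^ k - q1 ^ k)).
  { induction k as [ | k IH]; [simpl; lra | ].
    destruct IH as (IHd & IHs & IHw).
    assert (Hdif : forall p q, p ^ S k - q ^ S k = ((p ^ k - q ^ k) * (p + q) + (p ^ k + q ^ k) * (p - q)) / 2)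
      by (intros; simpl; field).
    assert (Hsum : forall p q, p ^ S k + q ^ S k = ((p ^ k + q ^ k) * (p + q) + (p ^ k - q ^ k) * (p - q)) / 2)
      by (intros; simpl; field).
    rewrite !Hdif, !Hsum. clear Hdif Hsum.
    revert IHd IHs IHw Hs Hd2 Hd Hwd.
    (* With the powers abstracted, every claim is a sum of two products of ordered nonnegative
       factors; [w1] and [w2] are attached to the difference factor in each product. *)
    generalize (p1 ^ k - q1 ^ k) (p2 ^ k - q2 ^ k) (p1 ^ k + q1 ^ k) (p2 ^ k + q2 ^ k).
    assert (Hs2 : 0 <= p2 + q2) by lra. revert Hs2.
    generalize (p1 + q1) (p2 + q2) (p1 - q1) (p2 - q2).
    clear - Hw. intros s1 s2 d1 d2 Hs2 D1 D2 S1 S2 HD HS HwD Hs Hd2 Hd Hwd.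
    assert (0 <= D2 * s2 <= D1 * s1) by (split; [apply Rmult_le_pos | apply Rmult_le_compat]; lra).
    assert (0 <= S2 * d2 <= S1 * d1) by (split; [apply Rmult_le_pos | apply Rmult_le_compat]; lra).
    assert (0 <= S2 * s2 <= S1 * s1) by (split; [apply Rmult_le_pos | apply Rmult_le_compat]; lra).
    assert (0 <= D2 * d2 <= D1 * d1) by (split; [apply Rmult_le_pos | apply Rmult_le_compat]; lra).
    assert ((w1 * D2) * s2 <= (w2 * D1) * s1).
    { apply Rmult_le_compat; try lra. apply Rmult_le_pos; lra. }
    assert (S2 * (w1 * d2) <= S1 * (w2 * d1)).
    { apply Rmult_le_compat; try lra. apply Rmult_le_pos; lra. }
    lra. }
  apply Hind.
Qed.

(** Around the centre [a + (d + 1) / 2], the half-width [(d + 1) / 2] gives the outer points [a] and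
    [a + d + 1], and [(1 - d) / 2] the inner points [a + d] and [a + 1]. The claim is a
    rearrangement of the ratio inequality. *)
Lemma four_point_le (a d : R) (k : nat) : 0 < a -> 0 < d <= 1 ->
  d * ((/ a) ^ k + (/ (a + d)) ^ k - (/ (a + 1)) ^ k - (/ (a + d + 1)) ^ k)
  <= (/ a) ^ k - (/ (a + d)) ^ k + (/ (a + 1)) ^ k - (/ (a + d + 1)) ^ k.
Proof.
  intros Ha Hd.
  pose proof (symmetric_difference_ratio (a + (d + 1) / 2) ((d + 1) / 2) ((1 - d) / 2) k
                ltac:(lra) ltac:(lra)) as H.
  replace (a + (d + 1) / 2 - (1 - d) / 2) with (a + d) in H by field.
  replace (a + (d + 1) / 2 + (1 - d) / 2) with (a + 1) in H by field.
  replace (a + (d + 1) / 2 - (d + 1) / 2) with a in H by field.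
  replace (a + (d + 1) / 2 + (d + 1) / 2) with (a + d + 1) in H by field.
  lra.
Qed.

(** Same points, but for [d >= 1] the inner two swap order, which reverses the inequality. *)
Lemma four_point_ge (a d : R) (k : nat) : 0 < a -> 1 <= d ->
  (/ a) ^ k - (/ (a + d)) ^ k + (/ (a + 1)) ^ k - (/ (a + d + 1)) ^ k
  <= d * ((/ a) ^ k + (/ (a + d)) ^ k - (/ (a + 1)) ^ k - (/ (a + d + 1)) ^ k).
Proof.
  intros Ha Hd.
  pose proof (symmetric_difference_ratio (a + (d + 1) / 2) ((d + 1) / 2) ((d - 1) / 2) k
                ltac:(lra) ltac:(lra)) as H.
  replace (a + (d + 1) / 2 - (d - 1) / 2) with (a + 1) in H by field.
  replace (a + (d + 1) / 2 + (d - 1) / 2) with (a + d) in H by field.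
  replace (a + (d + 1) / 2 - (d + 1) / 2) with a in H by field.
  replace (a + (d + 1) / 2 + (d + 1) / 2) with (a + d + 1) in H by field.
  lra.
Qed.

(* The trapezoidal rule overestimates the integral of the convex [y^(-k-1)] on [[a, a + 1]]. *)
Lemma trapezoid_inv_pow (a : R) (k : nat) : 0 < a ->
  2 * ((/ a) ^ k - (/ (a + 1)) ^ k) <= INR k * ((/ a) ^ S k + (/ (a + 1)) ^ S k).
Proof.
  intros Ha. set (p := / a). set (q := / (a + 1)).
  assert (Hq : 0 < q) by (apply Rinv_0_lt_compat; lra).
  assert (Hpq : q <= p) by (apply Rinv_le_contravar; lra).
  (* The unit length of the interval enters only through this relation; it turns the identity
     [Hstep] into one with products of [p] and [q]. *)
  assert (Hd : p - q = p * q) by (unfold p, q; field; lra).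
  induction k as [ | k IH]; [simpl; lra | ].
  rewrite S_INR.
  assert (Hpow : 0 <= q ^ S k <= p ^ S k) by (split; [apply pow_le | apply pow_incr]; lra).
  assert (H1 : (p ^ S k + q ^ S k) * (p + q) <= 2 * (p ^ S (S k) + q ^ S (S k))).
  { assert (0 <= (p ^ S k - q ^ S k) * (p - q)) by (apply Rmult_le_pos; lra).
    simpl in *. lra. }
  assert (H2 : (p ^ k + q ^ k) * (p * q) <= p ^ S (S k) + q ^ S (S k)).
  { assert (0 <= (p ^ S k - q ^ S k) * (p - q)) by (apply Rmult_le_pos; lra).
    simpl in *. lra. }
  assert (Hstep : 2 * (p ^ S k - q ^ S k) = (p ^ k - q ^ k) * (p + q) + (p ^ k + q ^ k) * (p * q)).
  { rewrite <- Hd. simpl. ring. }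
  rewrite Hstep.
  pose proof (pos_INR k).
  assert (2 * (p ^ k - q ^ k) * (p + q) <= INR k * (p ^ S k + q ^ S k) * (p + q))
    by (apply Rmult_le_compat_r; lra).
  assert (INR k * ((p ^ S k + q ^ S k) * (p + q)) <= INR k * (2 * (p ^ S (S k) + q ^ S (S k))))
    by (apply Rmult_le_compat_l; lra).
  lra.
Qed.

(** * Derivatives of [ln H] for [s <> t] and sufficient conditions *)

Definition lnH (s t lam x : R) : R :=
  (1 / (t - s) - lam) / 2 * ln (x + t) - (1 / (t - s) + lam) / 2 * ln (x + s)
  + 1 / (t - s) * (ln (Gamma (x + t)) - ln (Gamma (x + s))).

Definition lnH_ladder (s t lam : R) (k : nat) (x : R) : R :=
  / (t - s) * (polygamma k (x + s) - polygamma k (x + t))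
  + / (2 * (t - s)) * ((/ (x + t)) ^ k - (/ (x + s)) ^ k)
  - lam / 2 * ((/ (x + s)) ^ k + (/ (x + t)) ^ k).

Lemma dom_pos (s t x : R) : dom s t x -> 0 < x + s /\ 0 < x + t.
Proof.
  unfold dom. intros Hx. pose proof (Rmin_l s t). pose proof (Rmin_r s t). lra.
Qed.

Lemma dom_open (s t x : R) : dom s t x -> locally x (dom s t).
Proof. intros Hx. exact (open_gt _ x Hx). Qed.

Lemma H_exp_lnH (s t lam x : R) : s <> t -> dom s t x -> H s t lam x = exp (lnH s t lam x).
Proof.
  intros Hst Hx. destruct (dom_pos _ _ _ Hx) as [Hs Ht].
  pose proof (Gamma_pos _ Hs) as HGs. pose proof (Gamma_pos _ Ht) as HGt.
  unfold H. destruct (Req_EM_T s t) as [ | _]; [contradiction | ].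
  unfold lnH, Rpower, Rdiv.
  rewrite <- exp_Ropp, <- !exp_plus. f_equal.
  rewrite ln_mult, ln_Rinv by (try apply Rinv_0_lt_compat; assumption). ring.
Qed.

Lemma H_exp_diag (s lam x : R) : 0 < x + s ->
  H s s lam x = exp (- lam * ln (x + s) + psi (x + s) + / 2 * / (x + s)).
Proof.
  intros Hx. unfold H. destruct (Req_EM_T s s) as [_ | Hn]; [ | contradiction].
  unfold Rpower. rewrite <- exp_Ropp, <- exp_plus. f_equal. field. lra.
Qed.

Lemma is_derive_shift (f : R -> R) (c x l : R) :
  is_derive f (x + c) l -> is_derive (fun y => f (y + c)) x l.
Proof.
  intros Hf. replace l with (1 * l) by ring.
  apply (is_derive_comp f (fun y => y + c)); [exact Hf | ].
  auto_derive; [exact I | ring].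
Qed.

Lemma is_derive_ext_R (f g : R -> R) (x l : R) :
  (forall y, f y = g y) -> is_derive f x l -> is_derive g x l.
Proof. apply (is_derive_ext (V := R_NormedModule)). Qed.

Lemma is_derive_lin2 (f g : R -> R) (a b x f' g' : R) :
  is_derive f x f' -> is_derive g x g' ->
  is_derive (fun y => a * f y + b * g y) x (a * f' + b * g').
Proof.
  intros Hf Hg.
  apply (is_derive_plus (V := R_NormedModule) (fun y => a * f y) (fun y => b * g y));
    apply is_derive_scal; assumption.
Qed.

Lemma is_derive_ln_shift (c x : R) : 0 < x + c -> is_derive (fun y => ln (y + c)) x ((/ (x + c)) ^ 1).
Proof. intros Hx. auto_derive; [exact Hx | simpl; field; lra]. Qed.

Lemma lnH_derivative_ladder (s t lam : R) : s <> t ->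
  derivative_ladder (dom s t) (lnH s t lam) (lnH_ladder s t lam).
Proof.
  intros Hst. split.
  - intros x Hx. destruct (dom_pos _ _ _ Hx) as [Hs Ht].
    apply (is_derive_ext_R (fun y =>
      1 * ((1 / (t - s) - lam) / 2 * ln (y + t) + - ((1 / (t - s) + lam) / 2) * ln (y + s))
      + 1 * (1 / (t - s) * ln (Gamma (y + t)) + - (1 / (t - s)) * ln (Gamma (y + s)))));
      [intros y; unfold lnH; ring | ].
    replace (lnH_ladder s t lam 1 x) with
      (1 * ((1 / (t - s) - lam) / 2 * (/ (x + t)) ^ 1 + - ((1 / (t - s) + lam) / 2) * (/ (x + s)) ^ 1)
       + 1 * (1 / (t - s) * psi (x + t) + - (1 / (t - s)) * psi (x + s)))
      by (unfold lnH_ladder, polygamma; field; repeat split; lra).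
    apply is_derive_lin2; apply is_derive_lin2.
    + apply is_derive_ln_shift, Ht.
    + apply is_derive_ln_shift, Hs.
    + apply (is_derive_shift (fun y => ln (Gamma y))), ln_Gamma_derive_psi, Ht.
    + apply (is_derive_shift (fun y => ln (Gamma y))), ln_Gamma_derive_psi, Hs.
  - intros k x Hk Hx. destruct (dom_pos _ _ _ Hx) as [Hs Ht].
    apply (is_derive_ext_R (fun y =>
      1 * (/ (t - s) * polygamma k (y + s) + - / (t - s) * polygamma k (y + t))
      + 1 * ((/ (2 * (t - s)) - lam / 2) * (/ (y + t)) ^ k + (- / (2 * (t - s)) - lam / 2) * (/ (y + s)) ^ k)));
      [intros y; unfold lnH_ladder; ring | ].
    replace (- INR k * lnH_ladder s t lam (S k) x) with
      (1 * (/ (t - s) * (- INR k * polygamma (S k) (x + s)) + - / (t - s) * (- INR k * polygamma (S k) (x + t)))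
       + 1 * ((/ (2 * (t - s)) - lam / 2) * (- INR k * (/ (x + t)) ^ S k)
              + (- / (2 * (t - s)) - lam / 2) * (- INR k * (/ (x + s)) ^ S k)))
      by (unfold lnH_ladder; ring).
    apply is_derive_lin2; apply is_derive_lin2.
    + apply is_derive_shift, polygamma_derive; assumption.
    + apply is_derive_shift, polygamma_derive; assumption.
    + apply is_derive_inv_pow, Ht.
    + apply is_derive_inv_pow, Hs.
Qed.

Lemma lnH_ladder_sym (s t lam : R) (k : nat) (x : R) : s <> t ->
  lnH_ladder s t lam k x = lnH_ladder t s lam k x.
Proof. intros Hst. unfold lnH_ladder. field. lra. Qed.

Lemma lnH_ladder_step (s t lam : R) (k : nat) (x : R) :
  s < t -> - s < x -> (1 <= k)%nat ->
  lnH_ladder s t lam k x - lnH_ladder s t lam k (x + 1) =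
  / (2 * (t - s)) * ((/ (x + s)) ^ k - (/ (x + t)) ^ k + (/ (x + s + 1)) ^ k - (/ (x + t + 1)) ^ k)
  - lam / 2 * ((/ (x + s)) ^ k + (/ (x + t)) ^ k - (/ (x + s + 1)) ^ k - (/ (x + t + 1)) ^ k).
Proof.
  intros Hst Hx Hk. unfold lnH_ladder.
  replace (x + 1 + s) with (x + s + 1) by ring. replace (x + 1 + t) with (x + t + 1) by ring.
  rewrite !polygamma_shift by (lra || exact Hk). field. lra.
Qed.

Lemma is_lim_lnH_ladder (s t lam : R) (k : nat) : s < t -> (1 <= k)%nat ->
  is_lim (lnH_ladder s t lam k) p_infty 0.
Proof.
  intros Hst Hk. unfold lnH_ladder.
  replace (Finite 0) with (Finite (/ (t - s) * 0 + / (2 * (t - s)) * (0 - 0) - lam / 2 * (0 + 0)))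
    by (f_equal; ring).
  apply is_lim_minus'; [apply is_lim_plus' | ].
  - apply (is_lim_scal_l _ (/ (t - s)) p_infty 0), is_lim_polygamma_diff; [exact Hk | lra].
  - apply (is_lim_scal_l _ (/ (2 * (t - s))) p_infty (0 - 0)).
    apply is_lim_minus'; apply is_lim_inv_pow, Hk.
  - apply (is_lim_scal_l _ (lam / 2) p_infty (0 + 0)).
    apply is_lim_plus'; apply is_lim_inv_pow, Hk.
Qed.

(** The implications encode [lam <= min(1, 1 / (t - s))]. The step reduces the claim to
    [lam * (t - s) * den <= num]: for [t - s <= 1] this is [four_point_le], otherwise [den <= num]
    holds because [x + s + 1 <= x + t]. *)
Lemma lnH_ladder_nonneg (s t lam : R) (k : nat) (x : R) :
  s < t -> (t - s <= 1 -> lam <= 1) -> (1 <= t - s -> lam <= 1 / (t - s)) ->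
  - s < x -> (1 <= k)%nat -> 0 <= lnH_ladder s t lam k x.
Proof.
  intros Hst Hl1 Hl2 Hx Hk.
  apply (nonneg_of_step_decreasing (- s)); [ | apply is_lim_lnH_ladder; assumption | exact Hx].
  clear x Hx. intros x Hx.
  enough (0 <= lnH_ladder s t lam k x - lnH_ladder s t lam k (x + 1)) by lra.
  rewrite lnH_ladder_step by assumption.
  pose proof (inv_pow_antitone k (x + s) (x + s + 1) ltac:(lra)).
  pose proof (inv_pow_antitone k (x + t) (x + t + 1) ltac:(lra)).
  set (num := (/ (x + s)) ^ k - (/ (x + t)) ^ k + (/ (x + s + 1)) ^ k - (/ (x + t + 1)) ^ k).
  set (den := (/ (x + s)) ^ k + (/ (x + t)) ^ k - (/ (x + s + 1)) ^ k - (/ (x + t + 1)) ^ k).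
  assert (Hden : 0 <= den) by (unfold den; lra).
  enough (lam * (t - s) * den <= num).
  { replace (/ (2 * (t - s)) * num - lam / 2 * den)
      with (/ (2 * (t - s)) * (num - lam * (t - s) * den)) by (field; lra).
    apply Rmult_le_pos; [left; apply Rinv_0_lt_compat; lra | lra]. }
  destruct (Rle_lt_dec (t - s) 1) as [Hd | Hd].
  - apply Rle_trans with ((t - s) * den).
    + apply Rmult_le_compat_r; [exact Hden | ]. specialize (Hl1 Hd). nra.
    + pose proof (four_point_le (x + s) (t - s) k ltac:(lra) ltac:(lra)) as Hf.
      replace (x + s + (t - s)) with (x + t) in Hf by ring. exact Hf.
  - apply Rle_trans with den.
    + specialize (Hl2 ltac:(lra)).
      assert (lam * (t - s) <= 1 / (t - s) * (t - s)) by (apply Rmult_le_compat_r; lra).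
      replace (1 / (t - s) * (t - s)) with 1 in H1 by (field; lra). nra.
    + pose proof (inv_pow_antitone k (x + s + 1) (x + t) ltac:(lra)). unfold den, num. lra.
Qed.

(** Here [lam >= max(1, 1 / (t - s))], and the roles are exchanged: [num <= den] when [t - s <= 1],
    and [four_point_ge] otherwise. *)
Lemma lnH_ladder_nonpos (s t lam : R) (k : nat) (x : R) :
  s < t -> (t - s <= 1 -> 1 / (t - s) <= lam) -> (1 <= t - s -> 1 <= lam) ->
  - s < x -> (1 <= k)%nat -> lnH_ladder s t lam k x <= 0.
Proof.
  intros Hst Hl1 Hl2 Hx Hk.
  enough (0 <= (-1) * lnH_ladder s t lam k x) by lra.
  apply (nonneg_of_step_decreasing (- s) (fun x => (-1) * lnH_ladder s t lam k x)); [ | | exact Hx].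
  2: { replace (Finite 0) with (Finite ((-1) * 0)) by (f_equal; ring).
       apply (is_lim_scal_l _ (-1) p_infty 0), is_lim_lnH_ladder; assumption. }
  clear x Hx. intros x Hx.
  enough (lnH_ladder s t lam k x - lnH_ladder s t lam k (x + 1) <= 0) by lra.
  rewrite lnH_ladder_step by assumption.
  pose proof (inv_pow_antitone k (x + s) (x + s + 1) ltac:(lra)).
  pose proof (inv_pow_antitone k (x + t) (x + t + 1) ltac:(lra)).
  set (num := (/ (x + s)) ^ k - (/ (x + t)) ^ k + (/ (x + s + 1)) ^ k - (/ (x + t + 1)) ^ k).
  set (den := (/ (x + s)) ^ k + (/ (x + t)) ^ k - (/ (x + s + 1)) ^ k - (/ (x + t + 1)) ^ k).
  assert (Hden : 0 <= den) by (unfold den; lra).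
  enough (num <= lam * (t - s) * den).
  { replace (/ (2 * (t - s)) * num - lam / 2 * den)
      with (- (/ (2 * (t - s)) * (lam * (t - s) * den - num))) by (field; lra).
    enough (0 <= / (2 * (t - s)) * (lam * (t - s) * den - num)) by lra.
    apply Rmult_le_pos; [left; apply Rinv_0_lt_compat; lra | lra]. }
  destruct (Rle_lt_dec (t - s) 1) as [Hd | Hd].
  - apply Rle_trans with den.
    + pose proof (inv_pow_antitone k (x + t) (x + s + 1) ltac:(lra)). unfold den, num. lra.
    + specialize (Hl1 ltac:(lra)).
      assert (1 / (t - s) * (t - s) <= lam * (t - s)) by (apply Rmult_le_compat_r; lra).
      replace (1 / (t - s) * (t - s)) with 1 in H1 by (field; lra). nra.
  - apply Rle_trans with ((t - s) * den).
    + pose proof (four_point_ge (x + s) (t - s) k ltac:(lra) ltac:(lra)) as Hf.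
      replace (x + s + (t - s)) with (x + t) in Hf by ring. exact Hf.
    + apply Rmult_le_compat_r; [exact Hden | ]. specialize (Hl2 ltac:(lra)). nra.
Qed.

(** * Necessary conditions and the criterion for [s <> t] *)

(** Since [hurwitz 2 z] is [/ z] up to second order, this form shows that the first rung behaves
    like [(1 - lam) / x] at infinity. *)
Lemma lnH_ladder_at_infinity (s t lam x : R) : s < t -> - s < x ->
  exists z, x + s <= z <= x + t /\
    lnH_ladder s t lam 1 x =
    hurwitz 2 z - / 2 * / ((x + s) * (x + t)) - lam * (x + s + (t - s) / 2) * / ((x + s) * (x + t)).
Proof.
  intros Hst Hx.
  destruct (psi_increment (x + s) (t - s)) as (z & Hz & Heq); [lra | lra | ].
  exists z. split; [lra | ].
  replace (x + s + (t - s)) with (x + t) in Heq by ring.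
  unfold lnH_ladder, polygamma.
  replace (- psi (x + s) - - psi (x + t)) with ((t - s) * hurwitz 2 z) by lra.
  simpl. field. lra.
Qed.

Lemma lnH_nonpos_lam_ge_1 (s t lam : R) : s < t ->
  (forall x, - s < x -> lnH_ladder s t lam 1 x <= 0) -> 1 <= lam.
Proof.
  intros Hst Hneg. apply Rnot_lt_le. intros Hlam.
  (* With this [a] the numerator [a - / 2 - lam * (a + (t - s) / 2)] is at least [1], contradicting
     [Hfin]. *)
  set (a := (3 / 2 + Rabs lam * (t - s) / 2) / (1 - lam)).
  pose proof (Rabs_pos lam). pose proof (Rle_abs lam).
  assert (0 <= Rabs lam * (t - s)) by (apply Rmult_le_pos; lra).
  assert (Ha : 0 < a) by (apply Rdiv_lt_0_compat; lra).
  assert (Ha' : a * (1 - lam) = 3 / 2 + Rabs lam * (t - s) / 2) by (unfold a; field; lra).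
  specialize (Hneg (a - s) ltac:(lra)).
  destruct (lnH_ladder_at_infinity s t lam (a - s) Hst ltac:(lra)) as (z & Hz & Heq).
  replace (a - s + s) with a in * by ring. replace (a - s + t) with (a + (t - s)) in * by ring.
  rewrite Heq in Hneg.
  destruct (hurwitz2_bounds z) as [Hlo _]; [lra | ].
  assert (Hz' : / (a + (t - s)) <= / z) by (apply Rinv_le_contravar; lra).
  assert (Hab : 0 < a * (a + (t - s))) by (apply Rmult_lt_0_compat; lra).
  assert (Hfin : (a - / 2 - lam * (a + (t - s) / 2)) * / (a * (a + (t - s))) <= 0).
  { replace ((a - / 2 - lam * (a + (t - s) / 2)) * / (a * (a + (t - s))))
      with (/ (a + (t - s)) - / 2 * / (a * (a + (t - s))) - lam * (a + (t - s) / 2) * / (a * (a + (t - s))))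
      by (field; lra). lra. }
  apply (Rmult_le_compat_r (a * (a + (t - s)))) in Hfin; [ | lra].
  rewrite Rmult_assoc, Rinv_l in Hfin by lra.
  assert (lam * (t - s) <= Rabs lam * (t - s)) by (apply Rmult_le_compat_r; lra).
  lra.
Qed.

Lemma lnH_nonneg_lam_le_1 (s t lam : R) : s < t ->
  (forall x, - s < x -> 0 <= lnH_ladder s t lam 1 x) -> lam <= 1.
Proof.
  intros Hst Hpos. apply Rnot_lt_le. intros Hlam.
  (* The summand [1] ensures [(t - s) * / a <= t - s]; the rest makes the numerator in [Hfin]
     negative. *)
  set (a := 1 + (2 * (t - s) + 1) / (lam - 1)).
  assert (0 < (2 * (t - s) + 1) / (lam - 1)) by (apply Rdiv_lt_0_compat; lra).
  assert (Ha : 1 < a) by (unfold a; lra).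
  assert (Ha' : a * (lam - 1) = lam - 1 + (2 * (t - s) + 1)) by (unfold a; field; lra).
  specialize (Hpos (a - s) ltac:(lra)).
  destruct (lnH_ladder_at_infinity s t lam (a - s) Hst ltac:(lra)) as (z & Hz & Heq).
  replace (a - s + s) with a in * by ring. replace (a - s + t) with (a + (t - s)) in * by ring.
  rewrite Heq in Hpos.
  destruct (hurwitz2_bounds z) as [_ Hup]; [lra | ].
  assert (Hz' : 0 < / z <= / a) by (split; [apply Rinv_0_lt_compat | apply Rinv_le_contravar]; lra).
  assert (Hab : 0 < a * (a + (t - s))) by (apply Rmult_lt_0_compat; lra).
  assert ((/ z) ^ 2 <= (/ a) ^ 2) by (apply pow_incr; lra).
  assert (Hfin : 0 <= (a + (t - s) + (1 + (t - s) * / a) - / 2 - lam * (a + (t - s) / 2)) * / (a * (a + (t - s)))).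
  { replace ((a + (t - s) + (1 + (t - s) * / a) - / 2 - lam * (a + (t - s) / 2)) * / (a * (a + (t - s))))
      with (/ a + (/ a) ^ 2 - / 2 * / (a * (a + (t - s))) - lam * (a + (t - s) / 2) * / (a * (a + (t - s))))
      by (field; lra). lra. }
  apply (Rmult_le_compat_r (a * (a + (t - s)))) in Hfin; [ | lra].
  rewrite Rmult_assoc, Rinv_l in Hfin by lra.
  assert (/ a <= 1) by (rewrite <- Rinv_1; apply Rinv_le_contravar; lra).
  assert ((t - s) * / a <= (t - s) * 1) by (apply Rmult_le_compat_l; lra).
  nra.
Qed.

(** Replacing [psi a] by [psi (a + 1) - / a] isolates the pole at [a = 0]; what remains is bounded
    because [psi] is monotone on [[d, d + 1]] and [[1, 2]]. *)
Lemma lnH_ladder_at_endpoint (s t lam : R) : s < t ->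
  exists K, forall a, 0 < a <= 1 ->
    Rabs (lnH_ladder s t lam 1 (a - s) - (1 / (t - s) - lam) / (2 * a)) <= K.
Proof.
  intros Hst. set (d := t - s). assert (Hd : 0 < d) by (unfold d; lra).
  exists (/ d * (Rabs (psi (d + 1) - psi 1) + Rabs (psi d - psi 2)) + Rabs (/ (2 * d) - lam / 2) * / d).
  intros a Ha.
  replace (lnH_ladder s t lam 1 (a - s) - (1 / d - lam) / (2 * a))
    with (/ d * (psi (a + d) - psi (a + 1)) + (/ (2 * d) - lam / 2) * / (a + d)).
  - apply Rle_trans with (1 := Rabs_triang _ _). rewrite !Rabs_mult.
    apply Rplus_le_compat.
    + rewrite (Rabs_right (/ d)) by (left; apply Rinv_0_lt_compat; lra).
      apply Rmult_le_compat_l; [left; apply Rinv_0_lt_compat; lra | ].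
      pose proof (psi_incr d (a + d) ltac:(lra)). pose proof (psi_incr (a + d) (d + 1) ltac:(lra)).
      pose proof (psi_incr 1 (a + 1) ltac:(lra)). pose proof (psi_incr (a + 1) 2 ltac:(lra)).
      pose proof (Rle_abs (psi (d + 1) - psi 1)). pose proof (Rle_abs (- (psi d - psi 2))).
      rewrite Rabs_Ropp in *. pose proof (Rabs_pos (psi (d + 1) - psi 1)).
      pose proof (Rabs_pos (psi d - psi 2)). apply Rabs_le. lra.
    + apply Rmult_le_compat_l; [apply Rabs_pos | ].
      rewrite Rabs_right by (left; apply Rinv_0_lt_compat; lra).
      apply Rinv_le_contravar; lra.
  - unfold lnH_ladder, polygamma. fold d.
    replace (a - s + s) with a by ring. replace (a - s + t) with (a + d) by (unfold d; ring).
    rewrite psi_shift by lra. simpl. field. lra.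
Qed.

Lemma inv_unbounded_at_0 (m K : R) : 0 < m -> exists a, 0 < a <= 1 /\ K < m / (2 * a).
Proof.
  intros Hm. set (B := Rabs K + 1).
  assert (HB : 1 <= B /\ K < B).
  { pose proof (Rabs_pos K). pose proof (Rle_abs K). unfold B. lra. }
  (* Then [m / (2 * a) = B + m / 2 > K], and the [+ m] in the denominator keeps [a <= 1]. *)
  exists (m / (2 * B + m)). split; [split | ].
  - apply Rdiv_lt_0_compat; lra.
  - apply Rmult_le_reg_r with (2 * B + m); [lra | ].
    unfold Rdiv; rewrite Rmult_assoc, Rinv_l; lra.
  - replace (m / (2 * (m / (2 * B + m)))) with (B + m / 2) by (field; lra). lra.
Qed.

Lemma lnH_nonpos_lam_ge_inv (s t lam : R) : s < t ->
  (forall x, - s < x -> lnH_ladder s t lam 1 x <= 0) -> 1 / (t - s) <= lam.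
Proof.
  intros Hst Hneg. apply Rnot_lt_le. intros Hlam.
  destruct (lnH_ladder_at_endpoint s t lam Hst) as [K HK].
  destruct (inv_unbounded_at_0 (1 / (t - s) - lam) K ltac:(lra)) as (a & Ha & Hgt).
  specialize (HK a Ha). specialize (Hneg (a - s) ltac:(lra)).
  apply Rabs_le_between in HK. lra.
Qed.

Lemma lnH_nonneg_lam_le_inv (s t lam : R) : s < t ->
  (forall x, - s < x -> 0 <= lnH_ladder s t lam 1 x) -> lam <= 1 / (t - s).
Proof.
  intros Hst Hpos. apply Rnot_lt_le. intros Hlam.
  destruct (lnH_ladder_at_endpoint s t lam Hst) as [K HK].
  destruct (inv_unbounded_at_0 (lam - 1 / (t - s)) K ltac:(lra)) as (a & Ha & Hgt).
  specialize (HK a Ha). specialize (Hpos (a - s) ltac:(lra)).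
  apply Rabs_le_between in HK.
  replace ((1 / (t - s) - lam) / (2 * a)) with (- ((lam - 1 / (t - s)) / (2 * a))) in HK by (field; lra).
  lra.
Qed.

Lemma lnH_ladder_sign_lt (s t lam : R) : s < t ->
  ((forall k x, (1 <= k)%nat -> dom s t x -> lnH_ladder s t lam k x <= 0) <->
   1 <= lam /\ 1 / (t - s) <= lam) /\
  ((forall k x, (1 <= k)%nat -> dom s t x -> 0 <= lnH_ladder s t lam k x) <->
   lam <= 1 /\ lam <= 1 / (t - s)).
Proof.
  intros Hst. unfold dom. rewrite Rmin_left by lra. split; split.
  - intros Hn. split; [apply lnH_nonpos_lam_ge_1 with s t | apply lnH_nonpos_lam_ge_inv];
      auto using Nat.le_refl.
  - intros [H1 H2] k x Hk Hx. apply lnH_ladder_nonpos; auto.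
  - intros Hn. split; [apply lnH_nonneg_lam_le_1 with s t | apply lnH_nonneg_lam_le_inv];
      auto using Nat.le_refl.
  - intros [H1 H2] k x Hk Hx. apply lnH_ladder_nonneg; auto.
Qed.

(** A single criterion for all [s <> t], reduced to [s < t] by the symmetry of the ladder; the size
    of [Rabs (t - s)] only decides which of the two bounds is active. *)
Lemma log_cm_H (s t lam : R) : s <> t ->
  (log_completely_monotonic (H s t lam) (dom s t) <-> 1 <= lam /\ 1 / Rabs (t - s) <= lam) /\
  (log_completely_monotonic (fun x => / H s t lam x) (dom s t) <->
   lam <= 1 /\ lam <= 1 / Rabs (t - s)).
Proof.
  intros Hst.
  rewrite (log_cm_iff_ladder (dom s t) _ (lnH s t lam) (lnH_ladder s t lam)),
    (log_cm_inv_iff_ladder (dom s t) _ (lnH s t lam) (lnH_ladder s t lam))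
    by (auto using dom_open, H_exp_lnH, lnH_derivative_ladder).
  destruct (Rlt_or_le s t) as [Hlt | Hle].
  - rewrite Rabs_right by lra. apply lnH_ladder_sign_lt, Hlt.
  - rewrite Rabs_left by lra. replace (- (t - s)) with (s - t) by ring.
    destruct (lnH_ladder_sign_lt t s lam ltac:(lra)) as [H1 H2].
    rewrite <- H1, <- H2. unfold dom. rewrite (Rmin_comm t s).
    split; split; intros HD k x Hk Hx; specialize (HD k x Hk Hx);
      rewrite lnH_ladder_sym by congruence; exact HD.
Qed.

(** * The case [s = t] *)

(** The limit of [lnH_ladder s t lam k] as [t] tends to [s]. *)
Definition lnH_diag_ladder (s lam : R) (k : nat) (x : R) : R :=
  - lam * (/ (x + s)) ^ k
  + INR k * (hurwitz (S k) (x + s) - / 2 * (/ (x + s)) ^ S k).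

Lemma lnH_diag_derivative_ladder (s lam : R) :
  derivative_ladder (fun x => - s < x)
    (fun x => - lam * ln (x + s) + psi (x + s) + / 2 * / (x + s)) (lnH_diag_ladder s lam).
Proof.
  split.
  - intros x Hx.
    apply (is_derive_ext_R (fun y =>
      1 * (- lam * ln (y + s) + 1 * psi (y + s)) + / 2 * (/ (y + s)) ^ 1));
      [intros y; simpl; ring | ].
    replace (lnH_diag_ladder s lam 1 x) with
      (1 * (- lam * (/ (x + s)) ^ 1 + 1 * hurwitz 2 (x + s)) + / 2 * (- INR 1 * (/ (x + s)) ^ 2))
      by (unfold lnH_diag_ladder; simpl; ring).
    apply is_derive_lin2; [apply is_derive_lin2 | ].
    + apply is_derive_ln_shift; lra.
    + apply is_derive_shift, psi_derive; lra.
    + apply is_derive_inv_pow; lra.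
  - intros k x Hk Hx.
    apply (is_derive_ext_R (fun y =>
      1 * (- lam * (/ (y + s)) ^ k + INR k * hurwitz (S k) (y + s))
      + - (INR k / 2) * (/ (y + s)) ^ S k));
      [intros y; unfold lnH_diag_ladder; field | ].
    replace (- INR k * lnH_diag_ladder s lam (S k) x) with
      (1 * (- lam * (- INR k * (/ (x + s)) ^ S k) + INR k * (- INR (S k) * hurwitz (S (S k)) (x + s)))
       + - (INR k / 2) * (- INR (S k) * (/ (x + s)) ^ S (S k)))
      by (unfold lnH_diag_ladder; field).
    apply is_derive_lin2; [apply is_derive_lin2 | ].
    + apply is_derive_inv_pow; lra.
    + apply is_derive_shift, hurwitz_derive; [lia | lra].
    + apply is_derive_inv_pow; lra.
Qed.

Lemma is_lim_lnH_diag_ladder (s lam : R) (k : nat) : (1 <= k)%nat ->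
  is_lim (lnH_diag_ladder s lam k) p_infty 0.
Proof.
  intros Hk. unfold lnH_diag_ladder.
  replace (Finite 0) with (Finite (- lam * 0 + INR k * (0 - / 2 * 0))) by (f_equal; ring).
  apply is_lim_plus'.
  - apply (is_lim_scal_l _ (- lam) p_infty 0), is_lim_inv_pow, Hk.
  - apply (is_lim_scal_l _ (INR k) p_infty (0 - / 2 * 0)), is_lim_minus'.
    + apply is_lim_hurwitz. lia.
    + apply (is_lim_scal_l _ (/ 2) p_infty 0), is_lim_inv_pow. lia.
Qed.

(** The unit step of the ladder is [k / 2] times the sum of the [(k + 1)]-th powers minus [lam]
    times the difference of the [k]-th powers, so [trapezoid_inv_pow] settles it. *)
Lemma lnH_diag_ladder_nonneg (s lam : R) (k : nat) (x : R) :
  lam <= 1 -> (1 <= k)%nat -> - s < x -> 0 <= lnH_diag_ladder s lam k x.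
Proof.
  intros Hlam Hk Hx.
  apply (nonneg_of_step_decreasing (- s)); [ | apply is_lim_lnH_diag_ladder, Hk | exact Hx].
  clear x Hx. intros x Hx. unfold lnH_diag_ladder.
  replace (x + 1 + s) with (x + s + 1) by ring.
  rewrite hurwitz_shift by (lra || lia).
  pose proof (inv_pow_antitone k (x + s) (x + s + 1) ltac:(lra)).
  pose proof (trapezoid_inv_pow (x + s) k ltac:(lra)).
  assert (lam * ((/ (x + s)) ^ k - (/ (x + s + 1)) ^ k) <= 1 * ((/ (x + s)) ^ k - (/ (x + s + 1)) ^ k))
    by (apply Rmult_le_compat_r; lra).
  lra.
Qed.

Lemma log_cm_H_diag (s lam : R) :
  log_completely_monotonic (fun x => / H s s lam x) (fun x => - s < x) <-> lam <= 1.
Proof.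
  rewrite (log_cm_inv_iff_ladder _ _ _ (lnH_diag_ladder s lam)
    (fun x Hx => open_gt (- s) x Hx) (fun x Hx => H_exp_diag s lam x ltac:(lra))
    (lnH_diag_derivative_ladder s lam)).
  split; [ | intros Hlam k x; apply lnH_diag_ladder_nonneg, Hlam].
  intros Hpos. apply Rnot_lt_le. intros Hlam.
  (* With [lam = 1 + / a], the upper bound of [hurwitz2_bounds] makes the first rung at most
     [- / 2 * (/ a) ^ 2]. *)
  set (a := / (lam - 1)).
  assert (Ha : 0 < a) by (apply Rinv_0_lt_compat; lra).
  assert (Ha' : lam = 1 + / a) by (unfold a; rewrite Rinv_inv; ring).
  specialize (Hpos 1%nat (a - s) (Nat.le_refl 1) ltac:(lra)).
  unfold lnH_diag_ladder in Hpos. replace (a - s + s) with a in Hpos by ring.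
  destruct (hurwitz2_bounds a Ha) as [_ Hup].
  assert (0 < / a) by (apply Rinv_0_lt_compat, Ha).
  rewrite Ha' in Hpos. simpl in Hpos, Hup. nra.
Qed.

(** * Unit gap and case distinction *)

(** For [lam = 1] and [t - s = 1] or [-1], one of the two logarithms has coefficient zero and the
    other cancels against the functional equation of [Gamma]. *)
Lemma H_unit_gap (s t x : R) : Rabs (t - s) = 1 -> dom s t x -> H s t 1 x = 1.
Proof.
  intros Hst Hx. destruct (dom_pos _ _ _ Hx) as [Hs Ht].
  assert (Hne : s <> t) by (intros ->; rewrite Rminus_diag, Rabs_R0 in Hst; lra).
  rewrite H_exp_lnH by assumption.
  transitivity (exp 0); [f_equal; unfold lnH | apply exp_0].
  assert (Hcase : t = s + 1 \/ s = t + 1).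
  { revert Hst. unfold Rabs. destruct (Rcase_abs (t - s)); lra. }
  destruct Hcase as [-> | ->].
  - replace (x + (s + 1)) with (x + s + 1) by ring.
    rewrite ln_Gamma_shift by exact Hs. replace (s + 1 - s) with 1 by ring. field.
  - replace (x + (t + 1)) with (x + t + 1) by ring.
    rewrite ln_Gamma_shift by exact Ht. replace (t - (t + 1)) with (-1) by ring. field.
Qed.

Theorem theorem2 (s t lam : R) :
  (0 < Rabs (t - s) < 1 ->
     (log_completely_monotonic (H s t lam) (dom s t) <-> lam >= 1 / Rabs (t - s)) /\
     (log_completely_monotonic (fun x => / H s t lam x) (dom s t) <-> lam <= 1)) /\
  (Rabs (t - s) > 1 ->
     (log_completely_monotonic (H s t lam) (dom s t) <-> lam >= 1) /\
     (log_completely_monotonic (fun x => / H s t lam x) (dom s t)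
        <-> lam <= 1 / Rabs (t - s))) /\
  (s = t ->
     (log_completely_monotonic (fun x => / H s s lam x) (fun x => - s < x) <-> lam <= 1)) /\
  (Rabs (t - s) = 1 ->
     (lam <> 1 ->
        (log_completely_monotonic (H s t lam) (dom s t) <-> lam > 1) /\
        (log_completely_monotonic (fun x => / H s t lam x) (dom s t) <-> lam < 1)) /\
     (forall x, dom s t x -> H s t 1 x = 1)).
Proof.
  assert (Hne : 0 < Rabs (t - s) -> s <> t).
  { intros Hd ->. rewrite Rminus_diag, Rabs_R0 in Hd. lra. }
  split; [ | split; [ | split]].
  - intros Hd. destruct (log_cm_H s t lam) as [-> ->]; [apply Hne; lra | ].
    assert (1 < 1 / Rabs (t - s)).
    { apply Rmult_lt_reg_r with (Rabs (t - s)); [lra | ].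
      unfold Rdiv. rewrite Rmult_assoc, Rinv_l; lra. }
    lra.
  - intros Hd. destruct (log_cm_H s t lam) as [-> ->]; [apply Hne; lra | ].
    assert (1 / Rabs (t - s) < 1).
    { apply Rmult_lt_reg_r with (Rabs (t - s)); [lra | ].
      unfold Rdiv. rewrite Rmult_assoc, Rinv_l; lra. }
    lra.
  - intros _. apply log_cm_H_diag.
  - intros Hd. split; [ | intros x; apply H_unit_gap, Hd].
    (* Both bounds equal [1] here. At [lam = 1] the function and its inverse are the constant [1],
       hence both logarithmically completely monotonic, so the strict inequalities require
       [lam <> 1]. *)
    intros Hlam. destruct (log_cm_H s t lam) as [-> ->]; [apply Hne; lra | ].
    rewrite Hd. lra.
Qed.
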